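(* Let $b,\sigma:[0,T]\times\mathbb{R}\to\mathbb{R}$, $g:\mathbb{R}\to\mathbb{R}$, $x_0\in\mathbb{R}$, and let $X$ solve the one-dimensional SDE $\mathrm{d}X_t=b(t,X_t)\,\mathrm{d}t+\sigma(t,X_t)\,\mathrm{d}W_t$, $X_0=x_0$, $t\in[0,T]$, with $W$ a standard Brownian motion. Let $N$ be the number of uniform time steps and let $\widetilde X_N:\mathbb{R}^N\to\mathbb{R}$ be the terminal Euler–Maruyama (EM) map (defined in the context). Suppose that: (1) for any $t\in[0,T]$, the functions $b(t,\cdot)$, $\sigma(t,\cdot)$ and $g$ are $N$-times continuously differentiable, and for any $0\le k\le N$ the functions $\sup_{t\in[0,T]}|\partial_x^k b(t,x)|$, $\sup_{t\in[0,T]}|\partial_x^k\sigma(t,x)|$ and $\frac{\mathrm{d}^k}{\mathrm{d}x^k}g$ belong to $\mathcal{C}_p(\mathbb{R})$; (2) $b$ and $\sigma$ satisfy the linear growth condition: there is a constant $c>0$ such that $|b(t,x)|+|\sigma(t,x)|\le c(1+|x|)$; (3) $b,\sigma,g$ satisfy the regularity conditions (those of Kloeden and Platen, Numerical Solution of Stochastic Differential Equations, 1992) ensuring the first-order weak convergence of the EM scheme. If $\{\boldsymbol y_1,\dots,\boldsymbol y_m\}\subset[0,1]^N$ is an RQMC point set and $$\tilde I_{m,N}^{\mathrm{RQMC}}:=\frac1m\sum_{k=1}^m g\big(\widetilde X_N(\Phi^{-1}(\boldsymbol y_k))\big),$$ then there are constants $C(\varepsilon,N),C>0$ such that for any $\varepsilon>0$,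 $$\sqrt{\mathbb{E}\left[\left|\tilde I_{m,N}^{\mathrm{RQMC}}-\mathbb{E}[g(X_T)]\right|^2\right]}\le C(\varepsilon,N)\,m^{-1+\varepsilon}+C\,\frac1N .$$
   Context: Class $\mathcal{C}_p$: $f:\mathbb{R}^d\to\mathbb{R}$ belongs to $\mathcal{C}_p(\mathbb{R}^d)$ iff there are constants $M,K,B>0$ with $|f(x)|\le M|x|^K+B$ for all $x\in\mathbb{R}^d$. Euler–Maruyama map: for $\boldsymbol z=(z_1,\dots,z_N)\in\mathbb{R}^N$, $\Delta t=T/N$, $t_i=iT/N$, set $\widetilde X_0=x_0$ and, for $i=1,\dots,N$, $$\widetilde X_i(\boldsymbol z)=\widetilde X_{i-1}(\boldsymbol z)+b(t_{i-1},\widetilde X_{i-1}(\boldsymbol z))\Delta t+\sigma(t_{i-1},\widetilde X_{i-1}(\boldsymbol z))\sqrt{\Delta t}\,z_i .$$ First-order weak convergence of the EM scheme means that $|\mathbb{E}[g(\widetilde X_N(Z))]-\mathbb{E}[g(X_T)]|\le C/N$ for a constant $C$, where $Z\sim\mathcal N(0,I_N)$. $\Phi^{-1}$ is the inverse cumulative distribution function of the standard Gaussian distribution, applied componentwise. Star discrepancy of a point set $\mathcal P_m=\{\boldsymbol y_1,\dots,\boldsymbol y_m\}\subset[0,1]^s$: $D_m^*(\mathcal P_m)=\sup_{\boldsymbol a\in[0,1]^s}\big|\frac1m\sum_{j=1}^m\mathbf 1_{[\boldsymbol 0,\boldsymbol a)}(\boldsymbol y_j)-\prod_{\ell=1}^s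 a_\ell\big|$. RQMC point set ($s,m\ge1$): a random point set $\mathcal P_m=\{\boldsymbol y_1,\dots,\boldsymbol y_m\}$ in $[0,1]^s$ such that (i) each $\boldsymbol y_j$ is uniformly distributed on $[0,1]^s$; (ii) there is a constant $C_s>0$ independent of $m$ with $D_m^*(\mathcal P_m)\le C_s\frac{(\log m)^{s-1}}{m}$ almost surely. *)

(* Defs.v *)
From mathcomp Require Import all_boot all_order all_algebra.
From mathcomp Require Import all_classical all_reals all_analysis.

Set Implicit Arguments.
Unset Strict Implicit.
Unset Printing Implicit Defensive.

Import Order.TTheory GRing.Theory Num.Theory.
Import numFieldNormedType.Exports.

Local Open Scope classical_set_scope.
Local Open Scope ring_scope.

Section growth_and_smoothness.
Context {R : realType}.

(* The class C_p(R). Functions are extended-real-valued because the class is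
   applied to suprema over t, whose finiteness is part of the requirement. *)
Definition poly_growth (f : R -> \bar R) : Prop :=
  exists M K B : R, [/\ 0 < M, 0 < K, 0 < B &
    forall x : R, (`|f x| <= (M * `|x| `^ K + B)%:E)%E].

Definition continuously_differentiable (n : nat) (f : R -> R) : Prop :=
  (forall k, (k < n)%N -> forall x, derivable (derive1n k f) x 1) /\
  continuous (derive1n n f).

Definition sup_time (T : R) (n : nat) (a : R -> R -> R) (x : R) : \bar R :=
  ereal_sup [set (`|derive1n n (a t) x|)%:E | t in `[0, T]].

Definition smooth_data (T : R) (N : nat) (b sigma : R -> R -> R) (g : R -> R)
    : Prop :=
  [/\ forall t, 0 <= t <= T ->
        continuously_differentiable N (b t) /\
        continuously_differentiable N (sigma t),
      continuously_differentiable N g &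
      forall k, (k <= N)%N ->
        [/\ poly_growth (sup_time T k b),
            poly_growth (sup_time T k sigma) &
            poly_growth (EFin \o derive1n k g)]].

Definition linear_growth (T : R) (b sigma : R -> R -> R) : Prop :=
  exists2 c : R, 0 < c & forall t x : R, 0 <= t <= T ->
    `|b t x| + `|sigma t x| <= c * (1 + `|x|).

End growth_and_smoothness.

Section euler_maruyama.
Context {R : realType}.

(* [em_state T x0 b sigma z i] is the i-th state of the scheme with N steps;
   the paper's z_(i+1) is [z`_i], as sequences are indexed from 0. *)
Fixpoint em_state (T x0 : R) (b sigma : R -> R -> R) (N : nat)
    (z : N.-tuple R) (i : nat) : R :=
  if i is k.+1 then
    let x := em_state T x0 b sigma z k in
    let t := k%:R * T / N%:R in
    x + b t x * (T / N%:R) + sigma t x * Num.sqrt (T / N%:R) * z`_k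
  else x0.

Definition em_terminal (T x0 : R) (b sigma : R -> R -> R) (N : nat)
    (z : N.-tuple R) : R := em_state T x0 b sigma z N.

End euler_maruyama.

Section random_vectors.
Context {R : realType}.

(* Y has law mu^{(x) n}, i.e. its coordinates are independent with law mu. *)
Definition has_product_law d (O : measurableType d) (P : probability O R)
    (mu : set R -> \bar R) (n : nat) (Y : O -> n.-tuple R) : Prop :=
  measurable_fun [set: O] Y /\
  forall A : 'I_n -> set R, (forall i, measurable (A i)) ->
    P [set w | forall i, A i (tnth (Y w) i)] = (\prod_(i < n) mu (A i))%E.

Definition std_gaussian_vector d (O : measurableType d) (P : probability O R)
    (n : nat) (Z : O -> n.-tuple R) : Prop :=
  has_product_law P (normal_prob 0 1) Z.

Definition uniform_on_cube d (O : measurableType d) (P : probability O R)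
    (n : nat) (U : O -> n.-tuple R) : Prop :=
  has_product_law P (uniform_prob (@ltr01 R)) U.

Definition std_gaussian_cdf (x : R) : R := fine (normal_prob 0 1 `]-oo, x]).

(* Only the values at 0 < u < 1 are meaningful; elsewhere it is 0. *)
Definition std_gaussian_cdf_inv (u : R) : R :=
  xget 0 [set x | std_gaussian_cdf x = u].

End random_vectors.

Section rqmc.
Context {R : realType}.

Definition unit_cube (s : nat) : set (s.-tuple R) :=
  [set a | forall l, 0 <= tnth a l <= 1].

Definition anchored_box (s : nat) (a : s.-tuple R) : set (s.-tuple R) :=
  [set u | forall l, 0 <= tnth u l < tnth a l].

Definition star_discrepancy (m s : nat) (y : 'I_m -> s.-tuple R) : R :=
  sup [set `|m%:R^-1 * (\sum_(j < m) \1_(anchored_box a) (y j))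
             - \prod_(l < s) tnth a l| | a in @unit_cube s].

(* Cs is a parameter because it must not depend on m: a bound that is to be
   uniform in m quantifies Cs before m. *)
Definition rqmc_point_set (Cs : R) d (O : measurableType d)
    (P : probability O R) (m s : nat) (y : 'I_m -> O -> s.-tuple R) : Prop :=
  [/\ forall j w, unit_cube (y j w),
      forall j, uniform_on_cube P (y j) &
      {ae P, forall w, star_discrepancy (y ^~ w)
                       <= Cs * (ln m%:R ^+ s.-1 / m%:R)}].

Definition rqmc_estimator (T x0 : R) (b sigma : R -> R -> R) (g : R -> R)
    (m N : nat) (y : 'I_m -> N.-tuple R) : R :=
  m%:R^-1 * \sum_(k < m)
    g (em_terminal T x0 b sigma (map_tuple std_gaussian_cdf_inv (y k))).

End rqmc.

Section sde.
Context {R : realType} d (O : measurableType d) (P : probability O R).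
Implicit Types (F : R -> set (set O)) (W X H I : R -> O -> R).

Definition filtration (T : R) F : Prop :=
  (forall t, 0 <= t <= T ->
     sigma_algebra [set: O] (F t) /\ F t `<=` measurable) /\
  (forall s t, 0 <= s -> s <= t -> t <= T -> F s `<=` F t).

Definition measurable_wrt (G : set (set O)) (f : O -> R) : Prop :=
  forall B : set R, measurable B -> G (f @^-1` B).

Definition adapted (T : R) F H : Prop :=
  forall t, 0 <= t <= T -> measurable_wrt (F t) (H t).

Definition progressively_measurable (T : R) F H : Prop :=
  forall t, 0 <= t <= T -> forall B : set R, measurable B ->
    <<s [set A `*` E | A in (measurable : set (set R)) & E in F t] >>
      [set p : R * O | 0 <= p.1 <= t /\ B (H p.1 p.2)].

Record standard_brownian_motion (T : R) F W : Prop := {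
  bm_adapted : adapted T F W;
  bm_start : {ae P, forall w, W 0 w = 0};
  bm_continuous : {ae P, forall w, {within `[0, T], continuous (W ^~ w)}};
  (* W_t - W_s has law N(0, t - s) and is independent of F_s;
     [normal_prob] takes the standard deviation. *)
  bm_increments : forall s t, 0 <= s -> s < t -> t <= T ->
    forall (A : set O) (B : set R), F s A -> measurable B ->
    P (A `&` [set w | B (W t w - W s w)]) =
      (P A * normal_prob 0%R (Num.sqrt (t - s)) B)%E }.

Record simple_process := SimpleProcess {
  sp_size : nat;
  sp_time : nat -> R;
  sp_coef : nat -> O -> R }.

Definition simple_adapted (T : R) F (S : simple_process) : Prop :=
  [/\ forall k, (k <= sp_size S)%N -> 0 <= sp_time S k <= T,
      forall k, (k < sp_size S)%N -> sp_time S k <= sp_time S k.+1 &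
      forall k, (k < sp_size S)%N ->
        measurable_wrt (F (sp_time S k)) (sp_coef S k) /\
        exists M : R, forall w, `|sp_coef S k w| <= M].

Definition simple_value (S : simple_process) (s : R) (w : O) : R :=
  \sum_(k < sp_size S)
    sp_coef S k w * \1_(`]sp_time S k, sp_time S k.+1]) s.

Definition simple_integral W (S : simple_process) (t : R) (w : O) : R :=
  \sum_(k < sp_size S) sp_coef S k w *
    (W (Num.min (sp_time S k.+1) t) w - W (Num.min (sp_time S k) t) w).

(* I_t = int_0^t H dW for 0 <= t <= T: limit in probability of the integrals of
   simple adapted processes S_n with int_0^T |S_n - H|^2 ds -> 0 in
   probability. *)
Definition is_ito_integral (T : R) F W H I : Prop :=
  (forall t, 0 <= t <= T -> measurable_fun [set: O] (I t)) /\
  exists S : nat -> simple_process,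
    [/\ forall n, simple_adapted T F (S n),
        forall e : R, 0 < e ->
          (fun n => P [set w | (e%:E < \int[lebesgue_measure]_(s in `[0%R, T])
                ((simple_value (S n) s w - H s w) ^+ 2)%:E)%E])
            @ \oo --> 0%E &
        forall t, 0 <= t <= T -> forall e : R, 0 < e ->
          (fun n => P [set w | e < `|simple_integral W (S n) t w - I t w|])
            @ \oo --> 0%E].

Record sde_solution (T x0 : R) (b sigma : R -> R -> R) F W X : Prop := {
  sde_filtration : filtration T F;
  sde_brownian : standard_brownian_motion T F W;
  sde_adapted : adapted T F X;
  sde_continuous : {ae P, forall w, {within `[0, T], continuous (X ^~ w)}};
  sde_start : {ae P, forall w, X 0 w = x0};
  sde_drift_progressive :
    progressively_measurable T F (fun t w => b t (X t w));
  sde_diffusion_progressive :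
    progressively_measurable T F (fun t w => sigma t (X t w));
  sde_drift_integrable : {ae P, forall w,
    lebesgue_measure.-integrable `[0, T] (fun s => (b s (X s w))%:E)};
  sde_diffusion_square_integrable : {ae P, forall w,
    (\int[lebesgue_measure]_(s in `[0%R, T]) (sigma s (X s w) ^+ 2)%:E
      < +oo)%E};
  sde_equation : exists2 I : R -> O -> R,
    is_ito_integral T F W (fun t w => sigma t (X t w)) I &
    forall t, 0 <= t <= T -> {ae P, forall w,
      ((X t w)%:E = x0%:E
        + \int[lebesgue_measure]_(s in `[0%R, t]) (b s (X s w))%:E
        + (I t w)%:E)%E} }.

End sde.

(* The property of the data that the Kloeden-Platen regularity conditions
   ensure, for every solution of the SDE; C is independent of N. The
   expectations are extended reals: the bound entails that they are finite. *)
Definition em_first_order_weak {R : realType} (T x0 : R)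
    (b sigma : R -> R -> R) (g : R -> R) : Prop :=
  forall d (O : measurableType d) (P : probability O R)
    (F : R -> set (set O)) (W X : R -> O -> R),
  sde_solution P T x0 b sigma F W X ->
  exists C : R, forall N : nat, (0 < N)%N ->
  forall d' (O' : measurableType d') (P' : probability O' R)
    (Z : O' -> N.-tuple R), std_gaussian_vector P' Z ->
  (`|'E_P'[fun w => g (em_terminal T x0 b sigma (Z w))]
     - 'E_P[fun w => g (X T w)]| <= (C / N%:R)%:E)%E.

(* Main.v *)
Require Import Defs.
From HB Require Import structures.
From mathcomp Require Import all_boot all_order all_algebra.
From mathcomp Require Import all_classical all_reals all_analysis.
From mathcomp Require Import measurable_realfun lra ring.
Import Order.TTheory GRing.Theory Num.Theory.
Import numFieldNormedType.Exports.
Local Open Scope classical_set_scope.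
Local Open Scope ring_scope.

Set Implicit Arguments.
Unset Strict Implicit.
Unset Printing Implicit Defensive.

(* The payoff G = g o X_N has iterated partial derivatives up to order N, all of
   polynomial growth.  Composing it with a map that clips each coordinate to
   [-K, K] and rounds it to a grid of mesh 2K/m gives a combination of
   indicators of lower boxes whose coefficients are mixed increments of G,
   hence of total mass polynomial in K.  The quantile function maps lower boxes
   to anchored boxes, so the quadrature error of the rounded payoff is at most
   the star discrepancy times a power of K.  Since all Gaussian moments are
   finite, clipping costs O(K^-r) in mean square for every r.  The choice
   K = m^delta with delta small and r large makes everything O(m^(-1+eps)); the
   weak error of the scheme contributes the term in 1/N. *)

(** * Functions of polynomial growth with iterated partial derivatives *)

(* Points of R^N are functions on nat of which only the coordinates below N
   matter. *)
Section partial_derivatives.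
Context {R : realType}.
Implicit Types (z : nat -> R) (F G : (nat -> R) -> R) (i j n N : nat).

(** The obstacle is that the payoff composed with the quantile function is in general unbounded on
    the cube and of infinite variation, so the Koksma-Hlawka inequality does not apply to it
    directly. Clipping at K makes the variation finite, and rounding turns the inequality into a
    finite summation by parts, for which only linearity of the two averages and the error on boxes
    matter. Each of the N coordinates takes one increment, hence one derivative: this is where
    smoothness of order N is spent.

    Clipping also acts on the sample average, and the discrepancy does not control how far out the
    transformed points lie. The error there is dominated by K^-r times the average of a power of
    [coord_weight] over the points. Each point is uniform, so this average has a second moment
    bounded independently of m; only marginal laws enter, so dependence among the points does no
    harm.

    The grid has as many cells as there are points, so that rounding costs a power of K divided by
    m, which matches the discrepancy up to powers of K and of the logarithm. *)

Definition upd z i (x : R) : nat -> R := fun j => if j == i then x else z j.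

Lemma updK z i x y : upd (upd z i x) i y = upd z i y.
Proof. by apply/funext => j; rewrite /upd; case: (j == i). Qed.

Lemma upd_id z i : upd z i (z i) = z.
Proof. by apply/funext => j; rewrite /upd; case: eqP => // ->. Qed.

Lemma updC z i j x y : i != j -> upd (upd z i x) j y = upd (upd z j y) i x.
Proof.
move=> ij; apply/funext => k; rewrite /upd.
by case: (k =P j) => // ->; case: eqP => // ji; rewrite ji eqxx in ij.
Qed.

Definition is_partial i F F' : Prop :=
  forall z (x : R),
    is_derive x (1 : R) (fun y => F (upd z i y)) (F' (upd z i x)).

Lemma is_partial_cst i c : is_partial i (fun=> c) (fun=> 0).
Proof. by move=> z x; exact: is_derive_cst. Qed.

Lemma is_partial_coord i j :
  is_partial i (fun z => z j) (fun=> (j == i)%:R).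
Proof.
move=> z x; rewrite /upd; case: (j == i); first exact: is_derive_id.
exact: is_derive_cst.
Qed.

Lemma is_partialD i F G F' G' : is_partial i F F' -> is_partial i G G' ->
  is_partial i (fun z => F z + G z) (fun z => F' z + G' z).
Proof. by move=> dF dG z x; exact: is_deriveD. Qed.

Lemma is_partialM i F G F' G' : is_partial i F F' -> is_partial i G G' ->
  is_partial i (fun z => F z * G z) (fun z => F z * G' z + G z * F' z).
Proof. by move=> dF dG z x; exact: is_deriveM. Qed.

Lemma is_partial_comp i (f : R -> R) F F' : (forall x, derivable f x 1) ->
  is_partial i F F' ->
  is_partial i (fun z => f (F z)) (fun z => derive1 f (F z) * F' z).
Proof.
move=> df dF z x.
apply: (@is_derive1_comp _ f (fun y => F (upd z i y))); last exact: dF.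
by rewrite derive1E; exact: derivableP.
Qed.

Lemma is_partial_upd i j c F F' : j != i -> is_partial j F F' ->
  is_partial j (fun z => F (upd z i c)) (fun z => F' (upd z i c)).
Proof.
move=> ji dF z x; rewrite updC//.
under [X in is_derive _ _ X]eq_fun do rewrite updC//.
exact: dF.
Qed.

(* The recursion on the order replaces a Faa di Bruno formula: closure under
   products and composition is an induction on n. *)
Fixpoint differentiable_in N (Q : ((nat -> R) -> R) -> Prop) n F : Prop :=
  Q F /\ if n is m.+1 then
    forall i, (i < N)%N -> exists2 F', is_partial i F F' &
      differentiable_in N Q m F'
  else True.

Lemma differentiable_in0 N Q n F : differentiable_in N Q n F -> Q F.
Proof. by case: n => [|n] []. Qed.

Lemma differentiable_inS N Q n F i : differentiable_in N Q n.+1 F ->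
  (i < N)%N -> exists2 F', is_partial i F F' & differentiable_in N Q n F'.
Proof. by move=> [_ dF] /dF. Qed.

Lemma differentiable_inW N Q n F :
  differentiable_in N Q n.+1 F -> differentiable_in N Q n F.
Proof.
elim: n F => [|n IHn] F [QF dF]; first by split.
split=> // i iN; have [F' dFF' dF'] := dF i iN.
by exists F' => //; exact: IHn.
Qed.

Lemma differentiable_in_sub N (Q Q' : ((nat -> R) -> R) -> Prop) n F :
  (forall G, Q G -> Q' G) ->
  differentiable_in N Q n F -> differentiable_in N Q' n F.
Proof.
move=> QQ'; elim: n F => [|n IHn] F [QF dF]; first by split=> //; exact: QQ'.
split=> [|i iN]; first exact: QQ'.
by have [F' dFF' dF'] := dF i iN; exists F' => //; exact: IHn.
Qed.

(** The summand 1 makes powers monotone in the exponent, so bounds of different degrees merge by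
    adding the degrees. *)
Definition coord_weight N z : R := 1 + \sum_(i < N) `|z i|.

Lemma coord_weight_ge1 N z : 1 <= coord_weight N z.
Proof. by rewrite lerDl sumr_ge0. Qed.

Lemma coord_weight_ge0 N z : 0 <= coord_weight N z.
Proof. by rewrite (le_trans _ (coord_weight_ge1 N z)). Qed.

Lemma ler_coord_weight N z i : (i < N)%N -> `|z i| <= coord_weight N z.
Proof.
move=> iN; rewrite /coord_weight (bigD1 (Ordinal iN))//=.
by rewrite addrCA lerDl addr_ge0// sumr_ge0.
Qed.

Definition poly_bounded N F : Prop :=
  exists (A : R) (p : nat), 0 <= A /\ forall z, `|F z| <= A * coord_weight N z
    ^+ p.

Lemma poly_bounded_cst N c : poly_bounded N (fun=> c).
Proof. by exists `|c|, 0; split => // z; rewrite expr0 mulr1. Qed.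

Lemma poly_bounded_coord N j : (j < N)%N -> poly_bounded N (fun z => z j).
Proof.
by exists 1, 1; split => // z; rewrite expr1 mul1r; exact: ler_coord_weight.
Qed.

Lemma poly_boundedD N F G : poly_bounded N F -> poly_bounded N G ->
  poly_bounded N (fun z => F z + G z).
Proof.
move=> [A [p [A0 FA]]] [B [q [B0 GB]]]; exists (A + B), (p + q)%N.
split => [|z]; first exact: addr_ge0.
rewrite (le_trans (ler_normD _ _))// mulrDl lerD//.
  rewrite (le_trans (FA z))// ler_wpM2l// ler_weXn2l ?leq_addr//.
  exact: coord_weight_ge1.
rewrite (le_trans (GB z))// ler_wpM2l// ler_weXn2l ?leq_addl//.
exact: coord_weight_ge1.
Qed.

Lemma poly_boundedM N F G : poly_bounded N F -> poly_bounded N G ->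
  poly_bounded N (fun z => F z * G z).
Proof.
move=> [A [p [A0 FA]]] [B [q [B0 GB]]]; exists (A * B), (p + q)%N.
split => [|z]; first exact: mulr_ge0.
by rewrite normrM exprD mulrACA ler_pM.
Qed.

Definition poly_bounded1 (f : R -> R) : Prop :=
  exists (A : R) (p : nat), 0 <= A /\ forall x, `|f x| <= A * (1 + `|x|) ^+ p.

Lemma poly_bounded_comp N f F : poly_bounded1 f -> poly_bounded N F ->
  poly_bounded N (fun z => f (F z)).
Proof.
move=> [A [p [A0 fA]]] [B [q [B0 FB]]].
exists (A * (1 + B) ^+ p), (q * p)%N; split => [|z].
  by rewrite mulr_ge0// exprn_ge0// addr_ge0.
rewrite (le_trans (fA _))// -mulrA ler_wpM2l// exprM -exprMn.
rewrite lerXn2r ?nnegrE ?addr_ge0//.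
  by rewrite mulr_ge0 ?addr_ge0// exprn_ge0// coord_weight_ge0.
by rewrite mulrDl mul1r lerD// exprn_ege1// coord_weight_ge1.
Qed.

Definition poly_smooth N n := differentiable_in N (poly_bounded N) n.

Lemma poly_smooth_cst N n c : poly_smooth N n (fun=> c).
Proof.
elim: n c => [|n IHn] c; split=> //; try exact: poly_bounded_cst.
by move=> i _; exists (fun=> 0); [exact: is_partial_cst|exact: IHn].
Qed.

Lemma poly_smooth_coord N n j : (j < N)%N -> poly_smooth N n (fun z => z j).
Proof.
move=> jN; case: n => [|n]; split=> //; try exact: poly_bounded_coord.
move=> i _; exists (fun=> (j == i)%:R); first exact: is_partial_coord.
exact: poly_smooth_cst.
Qed.

Lemma poly_smoothD N n F G : poly_smooth N n F -> poly_smooth N n G ->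
  poly_smooth N n (fun z => F z + G z).
Proof.
elim: n F G => [|n IHn] F G [pF dF] [pG dG]; split=> //;
  try exact: poly_boundedD.
move=> i iN; have [F' dFF' dF'] := dF i iN; have [G' dGG' dG'] := dG i iN.
exists (fun z => F' z + G' z); first exact: is_partialD.
exact: IHn.
Qed.

Lemma poly_smoothM N n F G : poly_smooth N n F -> poly_smooth N n G ->
  poly_smooth N n (fun z => F z * G z).
Proof.
elim: n F G => [|n IHn] F G dF dG; move: (dF) (dG) => [pF ddF] [pG ddG].
  by split=> //; exact: poly_boundedM.
split; first exact: poly_boundedM.
move=> i iN; have [F' dFF' dF'] := ddF i iN; have [G' dGG' dG'] := ddG i iN.
exists (fun z => F z * G' z + G z * F' z); first exact: is_partialM.
by apply: poly_smoothD; apply: IHn => //; exact: differentiable_inW.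
Qed.

Lemma poly_smooth_comp N n f F :
  (forall k, (k < n)%N -> forall x, derivable (derive1n k f) x 1) ->
  (forall k, (k <= n)%N -> poly_bounded1 (derive1n k f)) ->
  poly_smooth N n F -> poly_smooth N n (fun z => f (F z)).
Proof.
elim: n f F => [|n IHn] f F df pf dF; move: (dF) => [pF ddF].
  by split=> //; apply: poly_bounded_comp => //; exact: (pf 0).
split; first by apply: poly_bounded_comp => //; exact: (pf 0).
move=> i iN; have [F' dFF' dF'] := ddF i iN.
exists (fun z => derive1 f (F z) * F' z).
  by apply: is_partial_comp => //; exact: (df 0).
apply: poly_smoothM => //; apply: IHn; last exact: differentiable_inW.
  by move=> k kn x; rewrite -derive1Sn; exact: df.
by move=> k kn; rewrite -derive1Sn; exact: pf.
Qed.

Definition weight_bounded N (A : R) p F : Prop :=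
  forall z, `|F z| <= A * coord_weight N z ^+ p.

Lemma weight_boundedW N A B p q F : 0 <= A -> A <= B -> (p <= q)%N ->
  weight_bounded N A p F -> weight_bounded N B q F.
Proof.
move=> A0 AB pq FA z; rewrite (le_trans (FA z))// ler_pM ?exprn_ge0//.
  exact: coord_weight_ge0.
by rewrite ler_weXn2l// coord_weight_ge1.
Qed.

(** At each order there are only N directions, so finitely many constants and degrees occur and
    their sums dominate them all. A single bound for all iterated partials is what the induction
    over coordinates in [koksma_hlawka] requires. *)
Lemma poly_smooth_uniform N n F : poly_smooth N n F ->
  exists (A : R) (p : nat),
    0 <= A /\ differentiable_in N (weight_bounded N A p) n F.
Proof.
elim: n F => [|n IHn] F [[A [p [A0 FA]]] dF]; first by exists A, p; do !split.
have /choice[h hP] (i : 'I_N) : exists Fp : ((nat -> R) -> R) * R * nat,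
    [/\ is_partial i F Fp.1.1, 0 <= Fp.1.2 &
        differentiable_in N (weight_bounded N Fp.1.2 Fp.2) n Fp.1.1].
  have [F' dFF' /IHn[B [q [B0 dF']]]] := dF i (ltn_ord i).
  by exists (F', B, q).
have h0 (i : 'I_N) : 0 <= (h i).1.2 by have [] := hP i.
exists (A + \sum_i (h i).1.2), (p + \sum_i (h i).2)%N.
split; first by rewrite addr_ge0// sumr_ge0.
split.
  apply: weight_boundedW FA => //; last exact: leq_addr.
  by rewrite lerDl sumr_ge0.
move=> i iN; have [dFF' B0 dF'] := hP (Ordinal iN).
exists (h (Ordinal iN)).1.1 => //.
apply: differentiable_in_sub dF' => G; apply: weight_boundedW => //.
  by rewrite (bigD1 (Ordinal iN))//= addrCA lerDl addr_ge0// sumr_ge0.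
by rewrite (bigD1 (Ordinal iN))//= addnCA leq_addr.
Qed.

End partial_derivatives.

(** * Smoothness of the Euler-Maruyama payoff in the Gaussian increments *)

Section em_smooth.
Context {R : realType}.

(** The recursion of [em_state] with a function on nat in place of the tuple, so that single
    coordinates can be varied by [upd]. *)
Fixpoint em_path (T x0 : R) (b sigma : R -> R -> R) (N : nat)
    (z : nat -> R) (i : nat) : R :=
  if i is k.+1 then
    let x := em_path T x0 b sigma N z k in
    let t := k%:R * T / N%:R in
    x + b t x * (T / N%:R) + sigma t x * Num.sqrt (T / N%:R) * z k
  else x0.

Lemma em_stateE T x0 b sigma N (z : N.-tuple R) i :
  em_state T x0 b sigma z i = em_path T x0 b sigma N (nth 0 z) i.
Proof. by elim: i => //= i ->. Qed.

Lemma poly_growth_bounded1 (f : R -> R) :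
  poly_growth (EFin \o f) -> poly_bounded1 f.
Proof.
move=> [M [K [B [M0 K0 B0 fM]]]].
(* The real exponent [K] is rounded up to an integer; this only enlarges the power because the base
   is [1 + |x|], which is at least 1. *)
exists (M + B), (Num.truncn K).+1; split; first by rewrite addr_ge0// ltW.
move=> x; have := fM x; rewrite /= lee_fin => /le_trans; apply.
have x1 : 1 <= 1 + `|x| by rewrite lerDl.
have K1 : K <= (Num.truncn K).+1%:R by rewrite ltW// truncnS_gt.
rewrite mulrDl lerD//; last by rewrite ler_peMr ?(ltW B0)// exprn_ege1.
rewrite ler_pM2l// -powR_mulrn ?(le_trans _ x1)//.
apply: (@le_trans _ _ ((1 + `|x|) `^ K)); last by rewrite ler_powR.
by rewrite ge0_ler_powR ?nnegrE ?(ltW K0)// ?lerDr ?(le_trans _ x1).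
Qed.

Lemma sup_time_bounded1 (T : R) k (a : R -> R -> R) t : 0 <= t <= T ->
  poly_growth (sup_time T k a) -> poly_bounded1 (derive1n k (a t)).
Proof.
move=> t0T [M [K [B [M0 K0 B0 aM]]]]; apply: poly_growth_bounded1.
exists M, K, B; split=> // x; apply: le_trans (aM x).
rewrite (le_trans _ (lee_abs _))//; apply: ereal_sup_ubound.
by exists t => //=; rewrite in_itv.
Qed.

Lemma em_path_smooth (T x0 : R) (b sigma : R -> R -> R) (g : R -> R) N i :
  0 < T -> (0 < N)%N -> smooth_data T N b sigma g -> (i <= N)%N ->
  poly_smooth N N (fun z => em_path T x0 b sigma N z i).
Proof.
move=> T0 N0 [dbs dg gr]; elim: i => [_|i IHi iN] /=.
  exact: poly_smooth_cst.
have t0T : 0 <= i%:R * T / N%:R <= T.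
  rewrite divr_ge0 ?mulr_ge0 ?(ltW T0)//= ler_pdivrMr ?ltr0n// mulrC.
  by rewrite ler_wpM2l ?ler_nat ?(ltW T0)// ltnW.
have [[db _] [ds _]] := dbs _ t0T; have IH := IHi (ltnW iN).
apply: poly_smoothD; first (apply: poly_smoothD => //).
  apply: poly_smoothM (poly_smooth_cst _ _ _).
  apply: poly_smooth_comp => // k /gr[pb _ _].
  exact: sup_time_bounded1 pb.
apply: poly_smoothM (poly_smooth_coord _ iN).
apply: poly_smoothM (poly_smooth_cst _ _ _).
apply: poly_smooth_comp => // k /gr[_ ps _].
exact: sup_time_bounded1 ps.
Qed.

Lemma payoff_smooth (T x0 : R) (b sigma : R -> R -> R) (g : R -> R) N :
  0 < T -> (0 < N)%N -> smooth_data T N b sigma g ->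
  poly_smooth N N (fun z => g (em_path T x0 b sigma N z N)).
Proof.
move=> T0 N0 sd; have [_ [dg _] gr] := sd.
apply: poly_smooth_comp => //; last exact: em_path_smooth sd _.
by move=> k /gr[_ _ pg]; exact: poly_growth_bounded1.
Qed.

End em_smooth.

(** * A discrete Koksma-Hlawka inequality *)

Section grid.
Context {R : realType}.
Variable x : nat -> R.

(** Rounds and clips at once: arguments below [x 0] go to [x 0], those above [x n] to [x n]. *)
Fixpoint grid_floor n (y : R) : R :=
  if n is k.+1 then (if x n <= y then x n else grid_floor k y) else x 0.

Lemma grid_floorP n y : exists2 k, (k <= n)%N & grid_floor n y = x k.
Proof.
elim: n => [|n [k kn IHn]] /=; first by exists 0.
by case: ifP => _; [exists n.+1|exists k => //; exact: leqW].
Qed.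

Hypothesis x_nondecr : {homo x : i j / (i <= j)%N >-> i <= j}.

(** The increments over the grid points above [y] telescope. Starting from the top value [f (x n)]
    leaves only indicators of lower half-lines, the ones that turn into sides of anchored boxes. *)
Lemma abel_summation n (f : R -> R) y :
  f (grid_floor n y) =
  f (x n) + \sum_(k < n) (-1) * ((y < x k.+1)%R%:R * (f (x k.+1) - f (x k))).
Proof.
elim: n => [|n IHn]; first by rewrite big_ord0 addr0.
rewrite [LHS]/=; case: ifPn => [xy|].
  rewrite big1 ?addr0// => k _; rewrite ltNge (le_trans _ xy) ?mul0r ?mulr0//.
  by apply: x_nondecr; exact: ltn_ord.
by rewrite -ltNge => yx; rewrite big_ord_recr/= yx IHn mul1r; ring.
Qed.

Lemma grid_floor_le n y : x 0 <= y -> grid_floor n y <= y.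
Proof. by move=> x0y; elim: n => //= n IHn; case: ifP. Qed.

Lemma grid_floor_ge n h y : (forall k, x k.+1 = x k + h) ->
  y <= x n + h -> y <= grid_floor n y + h.
Proof.
move=> xS; elim: n => //= n IHn yx; case: ifPn => //.
by rewrite -ltNge xS => /ltW.
Qed.

End grid.

(** * One-step increments and the derivatives that they spend *)

Section differences.
Context {R : realType}.
Implicit Types (z : nat -> R) (F : (nat -> R) -> R) (i j n N : nat) (K A h : R).

Definition box_bounded K A F : Prop :=
  forall z, (forall i, `|z i| <= K) -> `|F z| <= A.

Lemma upd_box K z i c : `|c| <= K -> (forall j, `|z j| <= K) ->
  forall j, `|upd z i c j| <= K.
Proof. by move=> cK zK j; rewrite /upd; case: (j == i). Qed.

Lemma differentiable_box0 N K A n : 0 <= A ->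
  differentiable_in N (box_bounded K A) n (fun=> 0).
Proof.
move=> A0; elim: n => [|n IHn]; split=> //; try by move=> z _; rewrite normr0.
by move=> i _; exists (fun=> 0); [exact: is_partial_cst|exact: IHn].
Qed.

Lemma is_partial_upd_same i c F :
  is_partial i (fun z => F (upd z i c)) (fun=> 0).
Proof.
move=> z x; under [X in is_derive _ _ X]eq_fun do rewrite updK.
exact: is_derive_cst.
Qed.

Lemma differentiable_box_upd N K A n i c F : 0 <= A -> `|c| <= K ->
  differentiable_in N (box_bounded K A) n F ->
  differentiable_in N (box_bounded K A) n (fun z => F (upd z i c)).
Proof.
move=> A0 cK; elim: n F => [|n IHn] F [FA dF]; split=> //;
  try by move=> z zK; apply: FA; exact: upd_box.
move=> j jN; have [->|ji] := eqVneq j i.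
  exists (fun=> 0); first exact: is_partial_upd_same.
  exact: differentiable_box0.
have [F' dFF' dF'] := dF j jN.
exists (fun z => F' (upd z i c)); first exact: is_partial_upd.
exact: IHn.
Qed.

Lemma is_partialB i F G F' G' : is_partial i F F' -> is_partial i G G' ->
  is_partial i (fun z => F z - G z) (fun z => F' z - G' z).
Proof. by move=> dF dG z x; exact: is_deriveB. Qed.

Lemma partial_increment i F F' A a b z : is_partial i F F' -> a <= b ->
  (forall c, a <= c <= b -> `|F' (upd z i c)| <= A) ->
  `|F (upd z i b) - F (upd z i a)| <= A * (b - a).
Proof.
move=> dF ab F'A.
have dFz c : is_derive c (1 : R) (fun y => F (upd z i y)) (F' (upd z i c)).
  exact: dF.
have [|c cab ->] := MVT_segment ab (fun c _ => dFz c).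
  apply/continuous_subspaceT => c.
  by apply/differentiable_continuous/derivable1_diffP; have [] := dFz c.
rewrite normrM (ger0_norm (x := b - a)) ?subr_ge0//.
by rewrite ler_wpM2r ?subr_ge0// F'A// -in_itv.
Qed.

Lemma partial_increment_box i F F' A K a b z : is_partial i F F' ->
  box_bounded K A F' -> (forall j, `|z j| <= K) -> `|a| <= K -> `|b| <= K ->
  `|F (upd z i b) - F (upd z i a)| <= A * `|b - a|.
Proof.
move=> dF F'A zK; wlog ab : a b / a <= b.
  move=> le_ab aK bK; case: (leP a b) => [ab|/ltW ba]; first exact: le_ab.
  by rewrite distrC (distrC b); exact: le_ab.
move=> /ler_normlP[aK _] /ler_normlP[_ bK].
rewrite (ger0_norm (x := b - a)) ?subr_ge0//.
apply: partial_increment dF ab _ => c /andP[ac cb].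
apply: F'A; apply: upd_box zK; rewrite ler_norml (le_trans cb)// andbT.
by rewrite lerNl (le_trans _ aK)// lerN2.
Qed.

(** The partials of the increment in other directions are increments of partials, and in direction i
    they vanish because that coordinate is frozen. The mean value theorem in direction i comes last,
    on the already differentiated function; it uses up one order and yields the factor [h]. *)
Lemma differentiable_box_diff N K A h n i a b F : (i < N)%N -> 0 <= A ->
  - K <= a -> a <= b -> b <= K -> b - a <= h ->
  differentiable_in N (box_bounded K A) n.+1 F ->
  differentiable_in N (box_bounded K (A * h)) n
    (fun z => F (upd z i b) - F (upd z i a)).
Proof.
move=> iN A0 Ka ab bK bah; have h0 : 0 <= h by rewrite (le_trans _ bah)
  ?subr_ge0.
elim: n F => [|n IHn] F dF; split=> //.
1,2: move=> z zK; have [F' dFF' /differentiable_in0 F'A] := differentiable_inS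
  dF iN;
  apply: (le_trans (y := A * (b - a))); last exact: ler_wpM2l;
  rewrite -(ger0_norm (x := b - a)) ?subr_ge0//;
  apply: partial_increment_box dFF' F'A zK _ _;
    rewrite ler_norml ?Ka ?bK ?andbT//=;
  [exact: le_trans bK|exact: le_trans ab].
move=> j jN; have [->|ji] := eqVneq j i.
  exists (fun=> 0 - 0).
    by apply: is_partialB; exact: is_partial_upd_same.
  by rewrite subrr; apply: differentiable_box0; exact: mulr_ge0.
have [F' dFF' dF'] := differentiable_inS dF jN.
exists (fun z => F' (upd z i b) - F' (upd z i a)).
  by apply: is_partialB; exact: is_partial_upd.
exact: IHn.
Qed.

End differences.

Section discrete_koksma_hlawka.
Context {R : realType}.
Implicit Types (z : nat -> R) (F f : (nat -> R) -> R) (t : nat -> option R).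
Variables (N n : nat) (K D : R).
Hypotheses (n_gt0 : (0 < n)%N) (K_gt0 : 0 < K) (D_ge0 : 0 <= D).

(** [None] leaves a coordinate free; it becomes a side of length 1 of the anchored box. *)
Definition lower_box t z : R :=
  \prod_(i < N) (if t i is Some c then (z i < c)%R%:R else 1).

(* [bd f c] stands for a bound [c] on the error of a quadrature rule on [f]. *)
Variable bd : ((nat -> R) -> R) -> R -> Prop.
Hypothesis bdD : forall f1 f2 c1 c2, bd f1 c1 -> bd f2 c2 ->
  bd (fun z => f1 z + f2 z) (c1 + c2).
Hypothesis bdZ : forall a f c, bd f c -> bd (fun z => a * f z) (`|a| * c).
Hypothesis bdW : forall f c1 c2, c1 <= c2 -> bd f c1 -> bd f c2.
Hypothesis bd_box : forall t, bd (lower_box t) D.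

Definition mesh : R := (K + K) / n%:R.
Definition grid_point k : R := - K + k%:R * mesh.
(** Coordinates outside [s] are set to 0, so for empty [s] the function at the quantized point is a
    constant: the base case of the induction on [s]. *)
Definition quantize (s : seq nat) z : nat -> R :=
  fun i => if i \in s then grid_floor grid_point n (z i) else 0.

Lemma mesh_ge0 : 0 <= mesh.
Proof. by rewrite divr_ge0 ?addr_ge0 ?(ltW K_gt0). Qed.

Lemma grid_pointS k : grid_point k.+1 = grid_point k + mesh.
Proof. by rewrite /grid_point -natr1 mulrDl mul1r addrA. Qed.

Lemma grid_point_last : grid_point n = K.
Proof.
by rewrite /grid_point /mesh mulrC divfK ?addKr// pnatr_eq0 -lt0n.
Qed.

Lemma grid_point_homo : {homo grid_point : i j / (i <= j)%N >-> i <= j}.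
Proof. by move=> i j ij; rewrite lerD2l ler_wpM2r ?mesh_ge0// ler_nat. Qed.

Lemma grid_point_norm k : (k <= n)%N -> `|grid_point k| <= K.
Proof.
move=> kn; rewrite ler_norml -{2}grid_point_last grid_point_homo// andbT.
by rewrite lerDl mulr_ge0// mesh_ge0.
Qed.

Lemma quantize_norm s z i : `|quantize s z i| <= K.
Proof.
rewrite /quantize; case: (i \in s); last by rewrite normr0 ltW.
by have [k kn ->] := grid_floorP grid_point n (z i); exact: grid_point_norm.
Qed.

Lemma quantize_dist s z i : i \in s -> `|z i| <= K ->
  `|z i - quantize s z i| <= mesh.
Proof.
rewrite /quantize ler_norml => -> /andP[Kz zK].
have x0z : grid_point 0 <= z i by rewrite /grid_point mul0r addr0.
have le1 := grid_floor_le n x0z.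
have : z i <= grid_floor grid_point n (z i) + mesh.
  apply: grid_floor_ge; first exact: grid_pointS.
  by rewrite grid_point_last (le_trans zK)// lerDl mesh_ge0.
rewrite ger0_norm ?subr_ge0//.
by rewrite lerBlDl.
Qed.

Lemma quantize_cons i s z : quantize (i :: s) z =
  upd (quantize s z) i (grid_floor grid_point n (z i)).
Proof.
apply/funext => j; rewrite /quantize /upd inE.
by case: (j =P i) => // ->.
Qed.

Lemma lower_box_upd t i c z : (i < N)%N -> t i = None ->
  lower_box (fun j => if j == i then Some c else t j) z =
  lower_box t z * (z i < c)%R%:R.
Proof.
move=> iN ti; rewrite /lower_box (bigD1 (Ordinal iN))//= eqxx mulrC.
rewrite [in RHS](bigD1 (Ordinal iN))//= ti mul1r; congr (_ * _).
by apply: eq_bigr => j; rewrite -val_eqE/= => /negbTE ->.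
Qed.

Lemma bd_sum (f : nat -> (nat -> R) -> R) p c :
  (forall k, (k < p)%N -> bd (f k) c) ->
  bd (fun z => \sum_(k < p) f k z) (p%:R * c).
Proof.
elim: p => [_|p IHp fc].
  (* The zero function gets its bound 0 as the multiple by 0 of a box. *)
  rewrite mul0r; have := bdZ 0 (bd_box (fun=> None)).
  by rewrite normr0 mul0r; congr bd; apply/funext => z; rewrite big_ord0 mul0r.
rewrite -natr1 mulrDl mul1r.
have := bdD (IHp (fun k kp => fc k (ltnW kp))) (fc p (ltnSn p)).
by congr bd; apply/funext => z; rewrite big_ord_recr.
Qed.

(* Summation by parts in the first coordinate of s rewrites F at the quantized
   point as boxes times one-step increments of F, and each increment spends
   one partial derivative. *)
Lemma koksma_hlawka s F A t : uniq s -> (forall i, i \in s -> (i < N)%N) ->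
  (forall i, i \in s -> t i = None) -> 0 <= A ->
  differentiable_in N (box_bounded K A) (size s) F ->
  bd (fun z => lower_box t z * F (quantize s z))
     (D * A * (1 + (K + K)) ^+ size s).
Proof.
elim: s F A t => [|i s IHs] F A t us sN st A0 dF.
  rewrite expr0 mulr1 mulrC.
  have FA : `|F (quantize [::] (fun=> 0))| <= A.
    by apply: (differentiable_in0 dF) => i; exact: quantize_norm.
  apply: (@bdW _ (`|F (quantize [::] (fun=> 0))| * D)).
    by rewrite ler_wpM2r.
  have := bdZ (F (quantize [::] (fun=> 0))) (bd_box t).
  by congr bd; apply/funext => z; rewrite mulrC.
move: us => /= /andP[/negP i_s us].
have iN : (i < N)%N by rewrite sN ?mem_head.
have ti : t i = None by rewrite st ?mem_head.
have sN' j : j \in s -> (j < N)%N by move=> js; rewrite sN// inE js orbT.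
have st' j : j \in s -> t j = None by move=> js; rewrite st// inE js orbT.
pose c := D * A * (1 + (K + K)) ^+ size s.
have h0 := mesh_ge0.
(* The boundary term of the summation by parts: coordinate i is frozen at the top grid point K and
   stays free in the box. *)
have last_term : bd (fun z => lower_box t z * F (upd (quantize s z) i K)) c.
  apply: (IHs (fun z => F (upd z i K))) => //.
  apply: differentiable_box_upd => //; first by rewrite ger0_norm ?(ltW K_gt0).
  exact: differentiable_inW.
have increments k : (k < n)%N -> bd (fun z => (-1) * (
    lower_box (fun j => if j == i then Some (grid_point k.+1) else t j) z *
    (F (upd (quantize s z) i (grid_point k.+1)) -
     F (upd (quantize s z) i (grid_point k))))) (c * mesh).
  move=> kn; have -> : c * mesh =
      `|-1| * (D * (A * mesh) * (1 + (K + K)) ^+ size s).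
    by rewrite normrN1 /c; ring.
  apply: bdZ; apply: (IHs (fun z => F (upd z i (grid_point k.+1)) -
                                    F (upd z i (grid_point k)))) => //.
  - by move=> j js; case: (j =P i) => [ji|_]; [rewrite ji in js|exact: st'].
  - exact: mulr_ge0.
  - apply: differentiable_box_diff dF => //.
    + by have := grid_point_norm (ltnW kn); rewrite ler_norml => /andP[].
    + exact: grid_point_homo.
    + by have := grid_point_norm kn; rewrite ler_norml => /andP[].
    + by rewrite grid_pointS addrAC subrr add0r.
have := bdD last_term (bd_sum increments).
(* The n increments cost [c * mesh] each, and n meshes make up the length [K + K]; so each
   coordinate multiplies the bound by [1 + (K + K)]. *)
have -> : c + n%:R * (c * mesh) = D * A * (1 + (K + K)) ^+ size (i :: s).
  rewrite mulrCA /mesh [n%:R * _]mulrC divfK ?pnatr_eq0 -?lt0n//.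
  by rewrite /c /= exprS; ring.
congr bd; apply/funext => z; rewrite quantize_cons.
rewrite (abel_summation grid_point_homo n
  (fun y => F (upd (quantize s z) i y))).
rewrite grid_point_last mulrDr mulr_sumr; congr (_ + _).
by apply: eq_bigr => k _; rewrite lower_box_upd//; ring.
Qed.

End discrete_koksma_hlawka.

(** * Pointwise error of clipping and rounding *)

Section quantization_error.
Context {R : realType}.
Implicit Types (z : nat -> R) (F : (nat -> R) -> R).

Lemma weight_bounded_box N (A K : R) p F : 0 <= A ->
  weight_bounded N A p F -> box_bounded K (A * (1 + N%:R * K) ^+ p) F.
Proof.
move=> A0 FA z zK; rewrite (le_trans (FA z))// ler_wpM2l//.
have K0 : 0 <= K := le_trans (normr_ge0 _) (zK 0%N).
rewrite lerXn2r ?nnegrE ?coord_weight_ge0 ?addr_ge0 ?mulr_ge0//.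
rewrite lerD2l (le_trans (ler_sum _ (fun (i : 'I_N) _ => zK i)))//.
by rewrite sumr_const card_ord mulr_natl.
Qed.

(** The coordinates are exchanged one at a time along points that stay in the box; each exchange
    costs a mean value estimate. *)
Lemma box_increment N n (K A h : R) F z z' : 0 <= A ->
  differentiable_in N (box_bounded K A) n.+1 F ->
  (forall i, `|z i| <= K) -> (forall i, `|z' i| <= K) ->
  (forall i, (i < N)%N -> `|z i - z' i| <= h) ->
  (forall i, (N <= i)%N -> z i = z' i) ->
  `|F z - F z'| <= N%:R * (A * h).
Proof.
move=> A0 dF zK z'K zz' zz'N.
pose w k := fun j => if (j < k)%N then z' j else z j.
have wS k : w k.+1 = upd (w k) k (z' k).
  apply/funext => j; rewrite /w /upd ltnS leq_eqVlt.
  by case: (j =P k) => [->|].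
have wk k : w k = upd (w k) k (z k).
  have e : w k k = z k by rewrite /w ltnn.
  by rewrite -e upd_id.
have wK k i : `|w k i| <= K by rewrite /w; case: (i < k)%N.
have step k : (k < N)%N -> `|F (w k) - F (w k.+1)| <= A * h.
  move=> kN; have [F' dFF' /differentiable_in0 F'A] := differentiable_inS dF kN.
  rewrite wS {1}wk (le_trans (partial_increment_box dFF' F'A _ _ _))//.
  by rewrite ler_wpM2l// zz'.
have FN k : (k <= N)%N -> `|F z - F (w k)| <= k%:R * (A * h).
  elim: k => [|k IHk] kN; first by rewrite mul0r /w subrr normr0.
  rewrite -natr1 mulrDl mul1r -[_ - _](subrKA (F (w k))).
  by rewrite (le_trans (ler_normD _ _))// lerD ?IHk ?step// ltnW.
have <- : w N = z'.
  by apply/funext => i; rewrite /w; case: ltnP => // /zz'N.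
exact: FN.
Qed.

(** Inside the box only rounding matters, which moves each coordinate by at most a mesh. Outside it
    the weight exceeds [K], so the factor [(coord_weight N z / K) ^+ r] is at least 1 and pays for
    bounding the two values of F separately. The exponent [r] is free, to be chosen according to the
    decay wanted in [K]. *)
Lemma quantization_error N m n (A K : R) p r F z : 0 <= A -> 1 <= K ->
  (0 < n)%N -> differentiable_in N (weight_bounded N A p) m.+1 F ->
  (forall i, (N <= i)%N -> z i = 0) ->
  `|F z - F (quantize n K (iota 0%N N) z)| <=
    N%:R * (A * (1 + N%:R * K) ^+ p * mesh n K) +
    2 * A * (1 + N%:R) ^+ p / K ^+ r * coord_weight N z ^+ (p + r).
Proof.
move=> A0 K1 n0 dF zN; have K0 : 0 < K := lt_le_trans ltr01 K1.
set B := A * (1 + N%:R * K) ^+ p; set q := quantize _ _ _ z.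
have NK0 : 0 <= 1 + N%:R * K by rewrite addr_ge0// mulr_ge0// ltW.
have B0 : 0 <= B by rewrite mulr_ge0// exprn_ge0.
have dFB : differentiable_in N (box_bounded K B) m.+1 F.
  by apply: differentiable_in_sub dF => G; exact: weight_bounded_box.
have qK i : `|q i| <= K by exact: quantize_norm.
have V0 := coord_weight_ge0 N z.
have [zK|] := pselect (forall i, `|z i| <= K).
  apply: (le_trans (y := N%:R * (B * mesh n K))).
    apply: (box_increment B0 dFB zK qK) => i iN.
      by apply: quantize_dist; rewrite ?mem_iota.
    by rewrite /q /quantize mem_iota/= add0n ltnNge iN zN.
  rewrite lerDl mulr_ge0 ?exprn_ge0// divr_ge0 ?exprn_ge0 ?(ltW K0)//.
  by rewrite !mulr_ge0// exprn_ge0// addr_ge0.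
move=> /existsNP[i /negP]; rewrite -ltNge => Kzi.
have iN : (i < N)%N.
  by rewrite ltnNge; apply/negP => /zN zi;
    rewrite zi normr0 ltNge (ltW K0) in Kzi.
have KV : K <= coord_weight N z := le_trans (ltW Kzi) (ler_coord_weight z iN).
have le2 : `|F z - F q| <= 2 * A * (1 + N%:R) ^+ p * coord_weight N z ^+ p.
  rewrite (le_trans (ler_normB _ _))//.
  rewrite [leRHS](_ : _ = A * ((1 + N%:R) * coord_weight N z) ^+ p +
                          A * ((1 + N%:R) * coord_weight N z) ^+ p); last first.
    by rewrite exprMn; ring.
  have N1 : 1 <= 1 + N%:R :> R by rewrite lerDl.
  apply: lerD.
    rewrite (le_trans ((differentiable_in0 dF) z))// ler_wpM2l//.
    rewrite lerXn2r ?nnegrE// ?mulr_ge0 ?(le_trans _ N1)//.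
    by rewrite ler_peMl.
  rewrite (le_trans ((differentiable_in0 dFB) _ qK))// ler_wpM2l//.
  rewrite lerXn2r ?nnegrE// ?mulr_ge0 ?(le_trans _ N1)//.
  rewrite mulrDl mul1r lerD ?coord_weight_ge1//.
  by rewrite ler_wpM2l.
rewrite (le_trans le2)// -[leLHS]add0r lerD//.
  by rewrite mulr_ge0// mulr_ge0// mesh_ge0.
have C0 : 0 <= 2 * A * (1 + N%:R) ^+ p * coord_weight N z ^+ p.
  by rewrite !mulr_ge0 ?exprn_ge0// addr_ge0.
rewrite [leRHS](_ : _ = 2 * A * (1 + N%:R) ^+ p * coord_weight N z ^+ p *
  (coord_weight N z ^+ r / K ^+ r)); last by rewrite exprD; ring.
rewrite ler_peMr// ler_pdivlMr ?exprn_gt0// mul1r.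
by rewrite lerXn2r ?nnegrE// ltW.
Qed.

End quantization_error.

(** * The standard Gaussian quantile function *)

Section gaussian_cdf.
Context {R : realType}.
Local Notation mu := (@lebesgue_measure R).
Local Notation N01 := (@normal_prob R 0 1).
Local Notation Phi := (@std_gaussian_cdf R).
Local Notation Phiinv := (@std_gaussian_cdf_inv R).

Lemma cdf_EFin x : N01 `]-oo, x] = (Phi x)%:E.
Proof. by rewrite /std_gaussian_cdf fineK// fin_num_measure. Qed.

Lemma std_gaussian_cdfB x y : x <= y ->
  (\int[mu]_(t in `]x, y]) (normal_pdf 0 1 t)%:E = (Phi y - Phi x)%:E)%E.
Proof.
move=> xy; rewrite EFinB -!cdf_EFin.
rewrite -[LHS]/(N01 `]x, y]).
have -> : `]x, y]%classic = `]-oo, y] `\` `]-oo, x] :> set R.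
  by rewrite -[RHS]setCK setCD setCitvl setUC -[LHS]setCK setCitv.
rewrite measureD ?setIidr//; first exact: subset_itvl.
by rewrite -ge0_fin_numE// fin_num_measure.
Qed.

Lemma std_gaussian_cdf_lipschitz x y : x <= y ->
  Phi y - Phi x <= normal_peak 1 * (y - x).
Proof.
move=> xy; rewrite -lee_fin -std_gaussian_cdfB//.
apply: (@le_trans _ _ (\int[mu]_(t in `]x, y]) (normal_peak 1)%:E)%E).
  apply: ge0_le_integral => //=.
  - by move=> t _; rewrite lee_fin normal_pdf_ge0.
  - by apply/measurable_EFinP/measurable_funTS; exact: measurable_normal_pdf.
  - by move=> t _; rewrite lee_fin normal_pdf_ub.
rewrite integral_cst//= lebesgue_measure_itv/= lte_fin.
by case: ifPn => // xy'; rewrite ?EFinM ?EFinB// mule0 lee_fin mulr_ge0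
  ?normal_peak_ge0 ?subr_ge0.
Qed.

Lemma std_gaussian_cdf_increasing x y : x < y -> Phi x < Phi y.
Proof.
move=> xy; rewrite -subr_gt0 -lte_fin -std_gaussian_cdfB ?ltW//.
(* A positive lower bound of the density on the interval, since [t ^+ 2] is at most the sum of the
   squares of the endpoints. *)
pose c := normal_peak 1 * expR (- (x ^+ 2 + y ^+ 2)).
have c0 : 0 < c by rewrite mulr_gt0 ?normal_peak_gt0 ?expR_gt0.
apply: (@lt_le_trans _ _ (\int[mu]_(t in `]x, y]) c%:E)%E).
  rewrite integral_cst//= lebesgue_measure_itv/= lte_fin xy.
  by rewrite mule_gt0 ?lte_fin ?subr_gt0.
apply: ge0_le_integral => //=.
- by move=> t _; rewrite lee_fin ltW.
- by apply/measurable_EFinP/measurable_funTS; exact: measurable_normal_pdf.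
- move=> t; rewrite in_itv/= => /andP[xt ty]; rewrite lee_fin normal_pdfE//.
  rewrite /normal_fun ler_pM2l ?normal_peak_gt0// ler_expR.
  rewrite subr0 expr1n mulNr lerN2.
  have : t ^+ 2 <= x ^+ 2 + y ^+ 2 by case: (leP 0 t) => t0; nra.
  by apply: le_trans; rewrite ler_pdivrMr// ler_peMr ?sqr_ge0// ler1n.
Qed.

Lemma std_gaussian_cdf_continuous : continuous Phi.
Proof.
have lip x y : `|Phi x - Phi y| <= normal_peak 1 * `|x - y|.
  wlog yx : x y / y <= x.
    by move=> le; case: (leP y x) => [/le//|/ltW/le]; rewrite distrC (distrC y).
  rewrite !ger0_norm ?subr_ge0//; first exact: std_gaussian_cdf_lipschitz.
  by move: yx; rewrite le_eqVlt =>
    /predU1P[->//|/std_gaussian_cdf_increasing/ltW].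
have p0 : 0 < normal_peak (1 : R) by exact: normal_peak_gt0.
move=> x; apply/cvgrPdist_lt => e e0; near=> y.
rewrite (le_lt_trans (lip _ _))// mulrC -ltr_pdivlMr//.
near: y; apply: cvgr_dist_lt; first exact: cvg_id.
by rewrite divr_gt0.
Unshelve. all: by end_near. Qed.

Lemma std_gaussian_cdf_gt0 x : 0 < Phi x.
Proof.
apply: le_lt_trans (std_gaussian_cdf_increasing (_ : x - 1 < x)).
  by rewrite fine_ge0.
by rewrite gtrBl.
Qed.

Lemma std_gaussian_cdf_lt1 x : Phi x < 1.
Proof.
apply: (lt_le_trans (std_gaussian_cdf_increasing (_ : x < x + 1))).
  by rewrite ltrDl.
by rewrite -lee_fin -cdf_EFin probability_le1.
Qed.

(** Under the Gaussian law the identity is a random variable with distribution function [Phi], so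
    the limits at infinity are those of any distribution function. *)
Let idRV : measurableTypeR R -> R := idfun.

#[local] HB.instance Definition _ :=
  @isMeasurableFun.Build _ _ _ _ idRV (@measurable_id _ _ setT).

Lemma std_gaussian_cdf_cvgy : Phi t @[t --> +oo] --> (1 : R).
Proof. exact/fine_cvg/(cvg_cdfy1 (idRV : {RV N01 >-> R})). Qed.

Lemma std_gaussian_cdf_cvgNy : Phi t @[t --> -oo] --> (0 : R).
Proof. exact/fine_cvg/(cvg_cdfNy0 (idRV : {RV N01 >-> R})). Qed.

Lemma std_gaussian_cdf_onto u : 0 < u < 1 -> exists x, Phi x = u.
Proof.
move=> /andP[u0 u1].
have [a au] : exists a, Phi a < u.
  exact: (filter_ex (cvgr_lt _ std_gaussian_cdf_cvgNy _ u0)).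
have [b ub] : exists b, u < Phi b.
  exact: (filter_ex (cvgr_gt _ std_gaussian_cdf_cvgy _ u1)).
have ab : a <= b.
  rewrite leNgt; apply/negP => /std_gaussian_cdf_increasing.
  by rewrite ltNge (ltW (lt_trans au ub)).
have [||c _ <-] := @IVT R Phi a b u ab; last by exists c.
  exact/continuous_subspaceT/std_gaussian_cdf_continuous.
by rewrite ge_min le_max (ltW au) (ltW ub) orbT.
Qed.

Lemma std_gaussian_cdf_invK u : 0 < u < 1 -> Phi (Phiinv u) = u.
Proof.
by move=> /std_gaussian_cdf_onto[x xu];
  apply: (@xgetPex _ 0 [set x | Phi x = u]); exists x.
Qed.

Lemma std_gaussian_cdf_mono : {mono Phi : x y / x <= y}.
Proof. by apply: le_mono => x y; exact: std_gaussian_cdf_increasing. Qed.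

Lemma std_gaussian_cdf_inv_lt u x : 0 < u < 1 ->
  (Phiinv u < x) = (u < Phi x).
Proof.
move=> /std_gaussian_cdf_invK {2}<-.
by rewrite (leW_mono std_gaussian_cdf_mono).
Qed.

Lemma std_gaussian_cdf_inv_out u : ~~ (0 < u < 1) -> Phiinv u = 0.
Proof.
move=> u01; apply: xgetPN => x /= xu; move: u01.
by rewrite -xu std_gaussian_cdf_gt0 std_gaussian_cdf_lt1.
Qed.

(** All points off the open unit interval go to the default value 0, so they belong to the preimage
    exactly when [0 < x]. *)
Lemma preimage_cdf_inv_lt x : Phiinv @^-1` `]-oo, x[ =
  `]0, Phi x[ `|` (if 0 < x then ~` `]0, 1[ else set0).
Proof.
apply/seteqP; split => u /=; rewrite !in_itv/=.
  case: (boolP (0 < u < 1)) => u01.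
    by rewrite std_gaussian_cdf_inv_lt// => ->; left; case/andP: u01 => ->.
  rewrite std_gaussian_cdf_inv_out// => ->; right.
  by rewrite /= in_itv/=; exact/negP.
case=> [/andP[u0 ux]|].
  by rewrite std_gaussian_cdf_inv_lt// u0 (lt_trans ux)// std_gaussian_cdf_lt1.
case: ifPn => //= x0; rewrite in_itv/= => /negP u01.
by rewrite std_gaussian_cdf_inv_out.
Qed.

Lemma measurable_std_gaussian_cdf_inv : measurable_fun setT Phiinv.
Proof.
move=> mD; apply: (measurability _ (RGenInftyO.measurableE R)) => //.
move=> /= _ [_ [x ->] <-]; rewrite setTI preimage_cdf_inv_lt.
by apply: measurableU => //; case: ifP => // _; exact: measurableC.
Qed.

Local Notation uniform01 := (uniform_prob (@ltr01 R)).

Lemma uniform_prob_itv a : 0 <= a <= 1 -> uniform01 `]0, a[ = a%:E.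
Proof.
move=> /andP[a0 a1]; rewrite /uniform_prob.
rewrite (eq_integral (fun=> 1%E)); last first.
  move=> x; rewrite inE/= in_itv/= /uniform_pdf => /andP[x0 xa].
  by rewrite (ltW x0) (le_trans (ltW xa) a1)/= subr0 invr1.
rewrite integral_cst//= mul1e lebesgue_measure_itv/= lte_fin.
case: ltP => [_|a0']; first by rewrite oppr0 adde0.
by congr EFin; apply/eqP; rewrite eq_le a0.
Qed.

Lemma uniform_prob_open01C : uniform01 (~` `]0, 1[) = 0%E.
Proof.
have u01 : uniform01 `]0, 1[ = 1%E by rewrite uniform_prob_itv ?ler01 ?lexx.
by rewrite probability_setC// [X in (1 - X)%E]u01 subee.
Qed.

Lemma normal_prob_lt x : N01 `]-oo, x[ = (Phi x)%:E.
Proof.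
have -> : `]-oo, x[%classic = `]-oo, x] `\` [set x] :> set R.
  apply/seteqP; split => y /=; rewrite !in_itv/= lt_neqAle.
    by case/andP => /eqP yx ->.
  by case=> -> /eqP ->.
have x0 : N01 [set x] = 0%E.
  apply: null_set_integral => //; last exact: lebesgue_measure_set1.
  by apply/measurable_EFinP/measurable_funTS; exact: measurable_normal_pdf.
rewrite -cdf_EFin measureD//; last by rewrite -ge0_fin_numE// fin_num_measure.
rewrite setIidr; first by rewrite [X in (_ - X)%E]x0 sube0.
by move=> _ ->; rewrite /= in_itv/=.
Qed.

Let quantileRV : measurableTypeR R -> measurableTypeR R := Phiinv.

#[local] HB.instance Definition _ :=
  @isMeasurableFun.Build _ _ _ _ quantileRV measurable_std_gaussian_cdf_inv.

(** Open lower half-lines are stable under intersection and generate the Borel sets, so agreement on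
    them suffices. There the preimage is an interval of length [Phi x], up to the null set where the
    quantile takes its default value. *)
Lemma uniform_prob_cdf_inv (A : set R) : measurable A ->
  uniform01 (Phiinv @^-1` A) = N01 A.
Proof.
move=> mA.
pose law : probability (measurableTypeR R) R :=
  distribution uniform01 (quantileRV : {RV uniform01 >-> measurableTypeR R}).
rewrite -[LHS]/(law A).
apply: (@measure_unique _ R (measurableTypeR R) (@RGenInftyO.G R)
  (fun k => `]-oo, k%:R[%classic) _ _ _ _ law N01) => //.
- exact: RGenInftyO.measurableE.
- move=> _ _ [x ->] [y ->]; exists (Num.min x y).
  by apply/seteqP; split=> z /=; rewrite !in_itv/= lt_min;
    [case=> -> ->|move/andP].
- by move=> k; exists k%:R.
- apply/seteqP; split=> // x _; exists (Num.truncn x).+1 => //=.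
  by rewrite in_itv/= truncnS_gt.
- move=> _ [x ->]; rewrite -[LHS]/(uniform01 (Phiinv @^-1` `]-oo, x[)).
  rewrite preimage_cdf_inv_lt.
  have Phi01 : 0 <= Phi x <= 1.
    by rewrite (ltW (std_gaussian_cdf_gt0 x)) (ltW (std_gaussian_cdf_lt1 x)).
  rewrite measureU; last 3 first.
  - by [].
  - by case: ifP => // _; exact: measurableC.
  - case: ifP => _; last by rewrite setI0.
    rewrite -subset0 => u [/=]; rewrite !in_itv/= => /andP[-> ux] [].
    by rewrite (lt_trans ux) ?std_gaussian_cdf_lt1.
  have out0 : uniform01 (if 0 < x then ~` `]0, 1[ else set0) = 0%E.
    by case: ifP => _; [exact: uniform_prob_open01C|exact: measure0].
  rewrite [X in (X + _)%E](uniform_prob_itv Phi01) [X in (_ + X)%E]out0.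
  by rewrite adde0; exact/esym/normal_prob_lt.
- by move=> k; apply: (@le_lt_trans _ _ 1%E) (ltry 1); exact: probability_le1.
Qed.

(** The Radon-Nikodym derivative and the explicit density have the same integral over every
    measurable set, hence agree almost everywhere. *)
Lemma ge0_integral_normal_prob (f : R -> \bar R) : measurable_fun setT f ->
  (forall x, 0 <= f x)%E ->
  (\int[N01]_x f x = \int[mu]_x (f x * (normal_pdf 0 1 x)%:E))%E.
Proof.
move=> mf f0; have dom := @normal_prob_dominates R 0 1.
rewrite -(Radon_Nikodym_SigmaFinite.change_of_variables dom)//.
have mg := measurable_int _ (Radon_Nikodym_SigmaFinite.f_integrable dom).
have mpdf : measurable_fun setT (EFin \o @normal_pdf R 0 1).
  by apply/measurable_EFinP; exact: measurable_normal_pdf.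
apply: ae_eq_integral => //; try exact: emeasurable_funM.
apply: ae_eqe_mul2l; apply: integral_ae_eq => //.
  exact: Radon_Nikodym_SigmaFinite.f_integrable.
by move=> A _ mA; rewrite -Radon_Nikodym_SigmaFinite.f_integral.
Qed.

Lemma powr_normal_fun_le n : exists2 c : R, 0 <= c &
  forall x, `|x| ^+ n * normal_fun 0 1 x <= c * normal_fun 0 (Num.sqrt 2) x.
Proof.
pose f : R := n.+1`!%:R; have f0 : 0 < f by rewrite ltr0n fact_gt0.
(* The exponent is split into two halves [y = x ^+ 2 / 4]. One half is the Gaussian of variance 2;
   the other absorbs the power through [1 + y ^+ n.+1 / n.+1! <= expR y], the source of the
   factorial and of the power of 4. *)
exists (f * 4 ^+ n.+1 + 1) => [|x]; first by rewrite addr_ge0// mulr_ge0// ltW.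
rewrite /normal_fun !subr0 sqr_sqrtr// expr1n.
set y := x ^+ 2 / 4; have y0 : 0 <= y by rewrite divr_ge0 ?sqr_ge0.
have -> : - x ^+ 2 / (1 *+ 2) = - y + - y by rewrite /y; field.
have -> : - x ^+ 2 / (2 *+ 2) = - y :> R by rewrite /y; field.
rewrite expRD mulrA ler_wpM2r ?expR_ge0// expRN ler_pdivrMr ?expR_gt0//.
have xn : `|x| ^+ n <= 1 + `|x| ^+ (2 * n.+1).
  have [x1|/ltW x1] := leP `|x| 1.
    by rewrite (le_trans (exprn_ile1 _ _ x1))// lerDl exprn_ge0.
  rewrite (le_trans (_ : _ <= `|x| ^+ (2 * n.+1)))// ?lerDr//.
  by rewrite ler_weXn2l// mulnS mul2n -addnn addnA leq_addl.
rewrite (le_trans xn)//.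
have ey := expR_ge1Dxn n y0.
have -> : `|x| ^+ (2 * n.+1) = f * 4 ^+ n.+1 * (y ^+ n.+1 / f).
  rewrite exprM real_normK ?num_real// /y expr_div_n.
  by field; rewrite !gt_eqF//= exprn_gt0.
rewrite mulrDl mul1r addrC lerD//;
  last by rewrite (le_trans _ ey)// lerDl divr_ge0 ?exprn_ge0// ltW.
rewrite ler_wpM2l ?mulr_ge0 ?(ltW f0)//.
by rewrite (le_trans _ ey)// lerDr.
Qed.

Lemma normal_moment_lty n : (\int[N01]_x (`|x| ^+ n)%:E < +oo)%E.
Proof.
have mX : measurable_fun setT (fun x : R => (`|x| ^+ n)%:E).
  by apply/measurable_EFinP; apply: measurable_funX; exact: normr_measurable.
rewrite ge0_integral_normal_prob//.
have s0 : Num.sqrt 2 != 0 :> R by rewrite gt_eqF// sqrtr_gt0.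
have [C C0 hC] := powr_normal_fun_le n.
pose c : R := C * normal_peak 1 / normal_peak (Num.sqrt 2).
have c0 : 0 <= c by rewrite divr_ge0 ?normal_peak_ge0// mulr_ge0
  ?normal_peak_ge0.
apply: (@le_lt_trans _ _
  (\int[mu]_x (c%:E * (normal_pdf 0 (Num.sqrt 2) x)%:E))%E).
  apply: ge0_le_integral => //=.
  - by move=> x _; rewrite lee_fin mulr_ge0 ?exprn_ge0 ?normal_pdf_ge0.
  - apply/measurable_EFinP; apply: measurable_funM;
      last exact: measurable_normal_pdf.
    exact/measurable_EFinP.
  - apply/measurable_EFinP; apply: measurable_funM => //.
    exact: measurable_normal_pdf.
  - move=> x _; rewrite -!EFinM lee_fin !normal_pdfE// /c [leRHS]mulrA divfK;
      last first.
      by rewrite gt_eqF// normal_peak_gt0.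
    by rewrite mulrCA [C * _]mulrC -mulrA ler_wpM2l ?normal_peak_ge0.
rewrite ge0_integralZl//=.
- by rewrite integral_normal_pdf mule1 ltry.
- by apply/measurable_EFinP; exact: measurable_normal_pdf.
- by move=> x _; rewrite lee_fin normal_pdf_ge0.
Qed.

End gaussian_cdf.

(** * Gaussian vectors obtained from uniform ones *)

Section gaussian_vectors.
Context {R : realType} d (O : measurableType d) (P : probability O R) (N : nat).
Local Notation N01 := (@normal_prob R 0 1).
Local Notation Phi := (@std_gaussian_cdf R).
Local Notation Phiinv := (@std_gaussian_cdf_inv R).

Lemma quantile_std_gaussian (U : O -> N.-tuple R) : uniform_on_cube P U ->
  std_gaussian_vector P (fun w => map_tuple Phiinv (U w)).
Proof.
move=> [mU lawU]; split.
  apply/measurable_fun_tnthP => i; have /measurable_fun_tnthP/(_ i) mUi := mU.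
  have := measurableT_comp measurable_std_gaussian_cdf_inv mUi.
  by congr measurable_fun; apply/funext => w; rewrite /= tnth_map.
move=> A mA; have := lawU (fun i => Phiinv @^-1` A i).
under eq_bigr do rewrite uniform_prob_cdf_inv//.
move=> <- => [|i]; last first.
  by rewrite -[X in measurable X]setTI; exact: measurable_std_gaussian_cdf_inv.
congr (P _); apply/seteqP; split => w /= Aw i; have := Aw i.
  by rewrite tnth_map.
by rewrite tnth_map.
Qed.

(** Needed because the correspondence between lower boxes and anchored boxes holds only where the
    quantile function is a true inverse. *)
Lemma uniform_on_open_cube (U : O -> N.-tuple R) : uniform_on_cube P U ->
  {ae P, forall w, forall i, 0 < tnth (U w) i < 1}.
Proof.
move=> [mU lawU]; pose A := [set w | forall i, 0 < tnth (U w) i < 1].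
have mA : measurable A.
  rewrite (_ : A = \bigcap_(i in [set: 'I_N])
      ((fun w => tnth (U w) i) @^-1` `]0, 1[)); last first.
    apply/seteqP; split => [w Aw i _|w Aw i]; first by rewrite /= in_itv;
      exact: Aw.
    by have := Aw i Logic.I; rewrite /= in_itv.
  apply: fin_bigcap_measurable => // i _; rewrite -[X in measurable X]setTI.
  by have /measurable_fun_tnthP/(_ i) mUi := mU; exact: mUi.
exists (~` A); split; [exact: measurableC| |by []].
suff PA : P A = 1%E by rewrite probability_setC// [X in (1 - X)%E]PA subee.
have lawA := lawU (fun=> `]0, 1[%classic) (fun=> measurable_itv _).
rewrite big1 in lawA => [|i _]; last by rewrite uniform_prob_itv ?ler01 ?lexx.
exact: lawA.
Qed.

Variable Z : O -> N.-tuple R.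
Hypothesis gaussZ : std_gaussian_vector P Z.

Lemma gaussian_measurable i : measurable_fun setT (fun w => tnth (Z w) i).
Proof. by have [/measurable_fun_tnthP/(_ i)] := gaussZ. Qed.

Lemma gaussian_measurable_nth k : measurable_fun setT (fun w => nth 0 (Z w) k).
Proof.
have [kN|Nk] := ltnP k N.
  have := gaussian_measurable (Ordinal kN).
  by congr measurable_fun; apply/funext => w; rewrite (tnth_nth 0).
rewrite (_ : (fun _ => _) = cst 0)//; apply/funext => w.
by rewrite nth_default// size_tuple.
Qed.

Lemma gaussian_weight_measurable n :
  measurable_fun setT (fun w => coord_weight N (nth 0 (Z w)) ^+ n).
Proof.
apply: measurable_funX; apply: measurable_funD => //.
apply: measurable_sum => i; apply: measurableT_comp;
  first exact: normr_measurable.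
exact: gaussian_measurable_nth.
Qed.

Lemma gaussian_marginal i (A : set R) : measurable A ->
  P [set w | A (tnth (Z w) i)] = N01 A.
Proof.
move=> mA; pose B j := if j == i then A else setT.
have -> : [set w | A (tnth (Z w) i)] = [set w | forall j, B j (tnth (Z w) j)].
  apply/seteqP; split => w /= Aw; last by have := Aw i; rewrite /B eqxx.
  by move=> j; rewrite /B; case: eqP => // ->.
rewrite gaussZ.2 => [|j]; last by rewrite /B; case: ifP.
rewrite (bigD1 i)//= /B eqxx big1 ?mule1// => j /negbTE ->.
exact: probability_setT.
Qed.

Lemma gaussian_moment i n :
  (\int[P]_w (`|tnth (Z w) i| ^+ n)%:E = \int[N01]_x (`|x| ^+ n)%:E)%E.
Proof.
have mX : measurable_fun setT (fun x : R => (`|x| ^+ n)%:E).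
  by apply/measurable_EFinP; apply: measurable_funX; exact: normr_measurable.
pose mXi := isMeasurableFun.Build _ _ _ (measurableTypeR R) _
  (gaussian_measurable i).
pose Xi : {RV P >-> measurableTypeR R} := HB.pack (fun w => tnth (Z w) i) mXi.
rewrite -[LHS]/(\int[P]_w
  ((fun x : measurableTypeR R => (`|x| ^+ n)%:E) \o Xi) w)%E.
rewrite -(ge0_integral_distribution Xi)//.
by apply: (eq_measure_integral N01) => A mA _; exact: gaussian_marginal.
Qed.

Lemma gaussian_lower_box_integral (t : nat -> option R) :
  (\int[P]_w (lower_box N t (nth 0 (Z w)))%:E =
   (\prod_(i < N) (if t i is Some c then Phi c else 1))%:E)%E /\
  P.-integrable setT (fun w => (lower_box N t (nth 0 (Z w)))%:E).
Proof.
pose B (i : 'I_N) : set R := if t i is Some c then `]-oo, c[%classic else setT.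
pose A := [set w | forall i, B i (tnth (Z w) i)].
have mB i : measurable (B i) by rewrite /B; case: (t i).
have mA : measurable A.
  rewrite (_ : A = \bigcap_(i in [set: 'I_N])
      ((fun w => tnth (Z w) i) @^-1` B i));
    last by apply/seteqP; split => w Aw i; have := Aw i => // /(_ Logic.I).
  apply: fin_bigcap_measurable => // i _; rewrite -[X in measurable X]setTI.
  exact: gaussian_measurable.
have -> : (fun w => (lower_box N t (nth 0 (Z w)))%:E) =
          (fun w => (\1_A w)%:E).
  apply/funext => w; congr EFin; rewrite /lower_box indicE.
  have [/set_mem Aw|/negP Aw] := boolP (w \in A).
    rewrite big1// => i _; have := Aw i.
    by rewrite /B (tnth_nth 0); case: (t i) => //= c; rewrite in_itv/= => ->.
  have /existsNP[i Bi] : ~ A w by rewrite inE in Aw.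
  apply/eqP; rewrite prodf_seq_eq0; apply/hasP; exists i;
    rewrite ?mem_index_enum//=.
  move: Bi; rewrite /B (tnth_nth 0); case: (t i) => //= c.
  by rewrite in_itv/= => /negP/negbTE ->.
split; last by apply: integrable_indic => //; rewrite ltey_eq fin_num_measure.
rewrite integral_indic// setIT [LHS](gaussZ.2 B mB) -prodEFin;
  apply: eq_bigr => i _.
rewrite /B; case: (t i) => [c|]; first exact: normal_prob_lt.
exact: probability_setT.
Qed.

End gaussian_vectors.

(** * Moments of the weight under the Gaussian law *)

Section coord_weight_moments.
Context {R : realType}.

Lemma powrD_le (a b : R) n : 0 <= a -> 0 <= b ->
  (a + b) ^+ n <= 2 ^+ n * (a ^+ n + b ^+ n).
Proof.
wlog ab : a b / a <= b.
  move=> le; case: (leP a b) => [ab|/ltW ba] a0 b0; first exact: le.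
  by rewrite addrC [in leRHS]addrC; exact: le.
move=> a0 b0; rewrite mulrDr -exprMn -exprMn
  (le_trans (_ : _ <= (2 * b) ^+ n))//.
  by rewrite lerXn2r ?nnegrE ?addr_ge0 ?mulr_ge0//; lra.
by rewrite lerDr exprn_ge0// mulr_ge0.
Qed.

Lemma coord_weight_power_le N n : exists2 c : R, 0 <= c &
  forall z, coord_weight N z ^+ n <= c * (1 + \sum_(i < N) `|z i| ^+ n).
Proof.
elim: N => [|N [c c0 IHN]].
  by exists 1 => // z; rewrite /coord_weight !big_ord0 !addr0 expr1n mulr1.
exists (2 ^+ n * (c + 1)) => [|z];
  first by rewrite mulr_ge0 ?exprn_ge0 ?addr_ge0.
rewrite /coord_weight !big_ord_recr/= !addrA -[1 + _]/(coord_weight N z).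
rewrite (le_trans (powrD_le _ (coord_weight_ge0 _ _) _))// -mulrA ler_wpM2l
  ?exprn_ge0//.
have S0 : 0 <= \sum_(i < N) `|z i| ^+ n by rewrite sumr_ge0// => i _;
  rewrite exprn_ge0.
have z0 : 0 <= `|z N| ^+ n by rewrite exprn_ge0.
rewrite [leRHS]mulrDr lerD//; last by rewrite ler_peMl// lerDr.
by rewrite (le_trans (IHN z))// ler_wpM2r ?addr_ge0// lerDl.
Qed.

(** The constant precedes the probability space, since it has to serve every m and every point
    set. *)
Lemma coord_weight_moment N n : exists2 c : R, 0 <= c &
  forall d (O : measurableType d) (P : probability O R) (Z : O -> N.-tuple R),
  std_gaussian_vector P Z ->
  (\int[P]_w (coord_weight N (nth 0 (Z w)) ^+ n)%:E <= c%:E)%E.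
Proof.
have [c c0 hc] := coord_weight_power_le N n.
pose mom := (\int[normal_prob 0 1]_x (`|x : R| ^+ n)%:E)%E.
have mom0 : (0 <= mom)%E by apply: integral_ge0 => x _;
  rewrite lee_fin exprn_ge0.
have momE : mom = (fine mom)%:E.
  by rewrite fineK// ge0_fin_numE// normal_moment_lty.
exists (c * (1 + N%:R * fine mom)).
  by rewrite mulr_ge0// addr_ge0// mulr_ge0// fine_ge0.
move=> d O P Z gZ.
have mZ i : measurable_fun setT (fun w => `|nth 0 (Z w) i| ^+ n).
  apply: measurable_funX; apply: measurableT_comp;
    first exact: normr_measurable.
  exact: gaussian_measurable_nth gZ _.
apply: (@le_trans _ _
  (\int[P]_w (c%:E * (1 + \sum_(i < N) (`|nth 0 (Z w) i| ^+ n)%:E)))%E).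
  apply: ge0_le_integral => //.
  - by move=> w _; rewrite lee_fin exprn_ge0// coord_weight_ge0.
  - by apply/measurable_EFinP; exact: gaussian_weight_measurable gZ n.
  - apply: emeasurable_funM => //; apply: emeasurable_funD => //.
    by apply: emeasurable_sum => i; exact/measurable_EFinP.
  - by move=> w _; rewrite sumEFin -EFinD -EFinM lee_fin.
have S0 w : (0 <= \sum_(i < N) (`|nth 0 (Z w) i| ^+ n)%:E)%E.
  by apply: sume_ge0 => i _; rewrite lee_fin exprn_ge0.
have mS : measurable_fun setT
    (fun w => (\sum_(i < N) (`|nth 0 (Z w) i| ^+ n)%:E)%E).
  by apply: emeasurable_sum => i; exact/measurable_EFinP.
rewrite ge0_integralZl//; last 2 first.
- exact: emeasurable_funD.
- by move=> w _; rewrite adde_ge0.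
rewrite EFinM lee_wpmul2l// ge0_integralD// integral_cst//= mul1e.
rewrite [X in (X + _)%E]probability_setT EFinD leeD2l//.
rewrite ge0_integral_sum//; last by move=> i; exact/measurable_EFinP.
rewrite (eq_bigr (fun=> (fine mom)%:E)) => [|i _].
  by rewrite sumEFin sumr_const card_ord mulr_natl.
rewrite -momE /mom -(gaussian_moment gZ i n).
by apply: eq_integral => w _; rewrite (tnth_nth 0).
Qed.

Lemma weight_bounded_integrable N (A : R) p F
    d (O : measurableType d) (P : probability O R) (Z : O -> N.-tuple R) :
  std_gaussian_vector P Z -> weight_bounded N A p F ->
  measurable_fun setT (fun w => F (nth 0 (Z w))) ->
  P.-integrable setT (fun w => (F (nth 0 (Z w)))%:E).
Proof.
move=> gZ FA mF; have [c _ /(_ _ _ _ _ gZ) Vc] := coord_weight_moment N p.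
have intV : P.-integrable setT
    (EFin \o (fun w => coord_weight N (nth 0 (Z w)) ^+ p)).
  apply/integrableP; split.
    by apply/measurable_EFinP; exact: gaussian_weight_measurable gZ p.
  under eq_integral do rewrite /= ger0_norm ?exprn_ge0 ?coord_weight_ge0//.
  exact: le_lt_trans (ltry c).
apply: le_integrable (integrableZl measurableT A intV) => //=.
  exact/measurable_EFinP.
by move=> w _; rewrite lee_fin (le_trans (FA _))// ler_norm.
Qed.

End coord_weight_moments.

(** * The error of a point set in terms of its star discrepancy *)

Section quadrature.
Context {R : realType} (N m : nat).
Hypothesis m_gt0 : (0 < m)%N.
Local Notation Phi := (@std_gaussian_cdf R).
Local Notation Phiinv := (@std_gaussian_cdf_inv R).
Variable u : 'I_m -> N.-tuple R.
Hypothesis u01 : forall k i, 0 < tnth (u k) i < 1.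

Definition gaussian_point (v : N.-tuple R) : nat -> R :=
  nth 0 (map_tuple Phiinv v).

Lemma star_discrepancy_ubound (a : N.-tuple R) : unit_cube a ->
  `|m%:R^-1 * (\sum_(j < m) \1_(anchored_box a) (u j)) - \prod_(l < N) tnth a l|
    <= star_discrepancy u.
Proof.
move=> a01; apply: ub_le_sup; last by exists a.
(* The real supremum bounds its elements only if the set is bounded above; the empirical frequency
   and the volume are each at most 1. *)
exists (m%:R^-1 * m%:R + 1) => _ [a' a'01 <-].
rewrite (le_trans (ler_normB _ _))// lerD//.
  rewrite ger0_norm ?mulr_ge0 ?sumr_ge0// ler_wpM2l//.
  by rewrite -[in leRHS](card_ord m) -sumr_const ler_sum.
rewrite ger0_norm; last by apply: prodr_ge0 => l _; have /andP[] := a'01 l.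
by apply: prodr_ile1 => l _; exact: a'01.
Qed.

Lemma lower_box_discrepancy (t : nat -> option R) :
  `|m%:R^-1 * (\sum_(k < m) lower_box N t (gaussian_point (u k)))
    - \prod_(i < N) (if t i is Some c then Phi c else 1)| <= star_discrepancy u.
Proof.
pose a := [tuple if t i is Some c then Phi c else 1 | i < N].
have aE i : tnth a i = if t i is Some c then Phi c else 1 by rewrite
  tnth_mktuple.
have a01 : unit_cube a.
  move=> i; rewrite aE; case: (t i) => [c|]; last by rewrite ler01 lexx.
  by rewrite (ltW (std_gaussian_cdf_gt0 c)) (ltW (std_gaussian_cdf_lt1 c)).
have := star_discrepancy_ubound a01.
under [X in _ - X]eq_bigr do rewrite aE.
congr (`|_ * _ - _| <= _); apply: eq_bigr => k _.
have zE i : gaussian_point (u k) (i : 'I_N) = Phiinv (tnth (u k) i).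
  by rewrite -tnth_map (tnth_nth 0).
rewrite indicE /lower_box; have [/set_mem ua|/negP ua] := boolP (u k \in _).
  rewrite big1// => i _; have /andP[_] := ua i; rewrite aE zE.
  by case: (t i) => // c; rewrite std_gaussian_cdf_inv_lt// => ->.
have /existsNP[i] : ~ anchored_box a (u k) by rewrite inE in ua.
(* The box can only be left through an upper face, as [0 < u]; and the face of a free coordinate, of
   side 1, is never reached, as [u < 1]. *)
have /andP[u0 u1] := u01 k i.
rewrite (ltW u0)/= aE => ai; apply/esym/eqP.
rewrite prodf_seq_eq0; apply/hasP; exists i; rewrite ?mem_index_enum//= zE.
move: ai; case: (t i) => [c|] //= /negP/negbTE uc.
by rewrite std_gaussian_cdf_inv_lt// uc.
Qed.

Context d (O : measurableType d) (P : probability O R) (Z : O -> N.-tuple R).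
Hypothesis gaussZ : std_gaussian_vector P Z.

(** The instance of [bd] for the point set. Integrability is carried along because additivity of the
    expectation depends on it. *)
Definition quadrature_bound (f : (nat -> R) -> R) (c : R) : Prop :=
  P.-integrable setT (fun w => (f (nth 0 (Z w)))%:E) /\
  `|m%:R^-1 * (\sum_(k < m) f (gaussian_point (u k)))
    - \int[P]_w f (nth 0 (Z w))| <= c.

Lemma quadrature_boundD f1 f2 c1 c2 :
  quadrature_bound f1 c1 -> quadrature_bound f2 c2 ->
  quadrature_bound (fun z => f1 z + f2 z) (c1 + c2).
Proof.
move=> [i1 b1] [i2 b2]; split.
  by under eq_fun do rewrite EFinD; exact: integrableD.
rewrite RintegralD// big_split/= mulrDr opprD addrACA.
by rewrite (le_trans (ler_normD _ _))// lerD.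
Qed.

Lemma quadrature_boundZ a f c : quadrature_bound f c ->
  quadrature_bound (fun z => a * f z) (`|a| * c).
Proof.
move=> [i1 b1]; split.
  by under eq_fun do rewrite EFinM; exact: integrableZl.
by rewrite RintegralZl// -mulr_sumr mulrCA -mulrBr normrM ler_wpM2l.
Qed.

Lemma quadrature_quantized n (K A : R) F : (0 < n)%N -> 0 < K -> 0 <= A ->
  differentiable_in N (box_bounded K A) N F ->
  quadrature_bound (fun z => F (quantize n K (iota 0%N N) z))
    (star_discrepancy u * A * (1 + (K + K)) ^+ N).
Proof.
move=> n0 K0 A0 dF.
have box t : quadrature_bound (lower_box N t) (star_discrepancy u).
  have [intE int] := gaussian_lower_box_integral gaussZ t.
  by split => //; rewrite /Rintegral intE; exact: lower_box_discrepancy.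
have D0 : 0 <= star_discrepancy u.
  by have [_] := box (fun=> None); apply: le_trans.
have := @koksma_hlawka _ N n K (star_discrepancy u) n0 K0 D0 quadrature_bound
  quadrature_boundD quadrature_boundZ _ box (iota 0%N N) F A (fun=> None).
rewrite size_iota => /(_ _ _ _ _ A0 dF) H.
have : quadrature_bound (fun z => lower_box N (fun=> None) z *
    F (quantize n K (iota 0%N N) z))
    (star_discrepancy u * A * (1 + (K + K)) ^+ N).
  apply: H => //; first by move=> f c1 c2 c12 [? fc]; split => //;
    exact: le_trans c12.
    exact: iota_uniq.
  by move=> i; rewrite mem_iota.
congr quadrature_bound; apply/funext => z.
by rewrite /lower_box big1 ?mul1r.
Qed.

(** The triangle inequality through the quantized payoff: quantization is paid once in the sample
    average and once in the expectation, whence [2 * a]. The moment bound [mu] covers the clipping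
    error only in the expectation; at the points the weights remain, to be averaged over the
    randomness later. *)
Lemma quadrature_error n p r (K A mu : R) F : (0 < N)%N -> (0 < n)%N -> 1 <= K
  ->
  0 <= A -> differentiable_in N (weight_bounded N A p) N F ->
  measurable_fun setT (fun w => F (nth 0 (Z w))) ->
  (\int[P]_w (coord_weight N (nth 0 (Z w)) ^+ (p + r))%:E <= mu%:E)%E ->
  let B := A * (1 + N%:R * K) ^+ p in
  let a := N%:R * (B * mesh n K) in
  let b := 2 * A * (1 + N%:R) ^+ p / K ^+ r in
  is_true (`|m%:R^-1 * (\sum_(k < m) F (gaussian_point (u k)))
      - \int[P]_w F (nth 0 (Z w))| <=
    m%:R^-1 *
      (\sum_(k < m) b * coord_weight N (gaussian_point (u k)) ^+ (p + r))
    + (2 * a + b * mu + star_discrepancy u * B * (1 + (K + K)) ^+ N)).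
Proof.
move=> N0 n0 K1 A0 dF mF Vmu B a b.
have K0 : 0 < K := lt_le_trans ltr01 K1.
have B0 : 0 <= B.
  by rewrite mulr_ge0// exprn_ge0// addr_ge0// mulr_ge0// ltW.
have dFB : differentiable_in N (box_bounded K B) N F.
  by apply: differentiable_in_sub dF => G; exact: weight_bounded_box.
set q := quantize n K (iota 0%N N).
have qerr (v : N.-tuple R) : `|F (nth 0 v) - F (q (nth 0 v))| <=
    a + b * coord_weight N (nth 0 v) ^+ (p + r).
  have dF' : differentiable_in N (weight_bounded N A p) N.-1.+1 F.
    by rewrite prednK.
  apply: (quantization_error r A0 K1 n0 dF') => i Ni.
  by rewrite nth_default// size_tuple.
have [intq errq] := quadrature_quantized n0 K0 B0 dFB.
pose V w := coord_weight N (nth 0 (Z w)) ^+ (p + r).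
have V0 w : 0 <= V w by rewrite exprn_ge0// coord_weight_ge0.
have b0 : 0 <= b.
  by rewrite divr_ge0 ?exprn_ge0 ?(ltW K0)// mulr_ge0 ?exprn_ge0 ?addr_ge0//
    mulr_ge0.
have a0 : 0 <= a by rewrite mulr_ge0// mulr_ge0// mesh_ge0.
have intV : P.-integrable setT (EFin \o V).
  have VA : weight_bounded N (1 : R) (p + r)
      (fun z => coord_weight N z ^+ (p + r)).
    by move=> z; rewrite mul1r ger0_norm// exprn_ge0// coord_weight_ge0.
  have mV := gaussian_weight_measurable gaussZ (p + r).
  exact: (weight_bounded_integrable gaussZ VA mV).
have intU : P.-integrable setT (EFin \o (fun w => a + b * V w)).
  have -> : EFin \o (fun w => a + b * V w) =
      (cst a%:E \+ (fun w => b%:E * (EFin \o V) w))%E by [].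
  apply: integrableD => //; first exact: finite_measure_integrable_cst.
  exact: integrableZl.
have intF := weight_bounded_integrable gaussZ (differentiable_in0 dF) mF.
have intH : P.-integrable setT
    (EFin \o (fun w => F (nth 0 (Z w)) - F (q (nth 0 (Z w))))).
  exact: integrableB intF intq.
set avgF := _ * _; set EF := (\int[P]_w F _)%R.
set avgq := m%:R^-1 * \sum_(k < m) F (q (gaussian_point (u k))) in errq.
set Eq := (\int[P]_w F (q _))%R in errq.
have err1 : `|avgF - avgq| <= m%:R^-1 *
    (\sum_(k < m) b * coord_weight N (gaussian_point (u k)) ^+ (p + r)) + a.
  rewrite /avgF /avgq -mulrBr -sumrB normrM ger0_norm//.
  have -> : a = m%:R^-1 * \sum_(k < m) a.
    by rewrite sumr_const card_ord -[a *+ m]mulr_natl mulKf// pnatr_eq0 -lt0n.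
  rewrite -mulrDr -big_split/= ler_wpM2l// (le_trans (ler_norm_sum _ _ _))//.
  by apply: ler_sum => k _; rewrite addrC; exact: qerr.
have err2 : `|Eq - EF| <= a + b * mu.
  rewrite distrC /Eq /EF -RintegralB// (le_trans (le_normr_Rintegral _ _))//.
  have le2 : (\int[P]_w (a + b * V w) <= a + b * mu)%R.
    rewrite RintegralD//; last 2 first.
    - exact: finite_measure_integrable_cst.
    - by have := integrableZl measurableT b intV.
    rewrite Rintegral_cst// [X in fine X]probability_setT mulr1 lerD2l
      RintegralZl//.
    rewrite ler_wpM2l// -lee_fin fineK//.
    exact: integrable_fin_num.
  apply: le_trans le2; apply: le_Rintegral => //.
  exact: integrable_abse intH.
rewrite (_ : avgF - EF = (avgF - avgq) + (avgq - Eq) + (Eq - EF)); last by ring.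
rewrite (le_trans (ler_normD _ _))// (le_trans (lerD (ler_normD _ _) (lexx
  _)))//.
rewrite (le_trans (lerD (lerD err1 errq) err2))// le_eqVlt; apply/orP; left.
by apply/eqP; ring.
Qed.

End quadrature.

(** * Choice of the truncation level *)

Section rate.
Context {R : realType}.

(* With K = m^delta, where delta q = eps, every polynomial in K of degree at
   most q is O(m^eps), and K^-r <= 1/m as soon as r delta >= 1. *)
Lemma truncation_rate (N p : nat) (A Cs eps : R) :
  (0 < N)%N -> 0 <= A -> 0 <= Cs -> 0 < eps ->
  exists r : nat, forall mu : R, 0 <= mu ->
  exists C1 C2 : R, [/\ 0 <= C1, 0 <= C2 &
  forall m : nat, (0 < m)%N -> exists2 K : R, 1 <= K &
  let B := A * (1 + N%:R * K) ^+ p in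
  let a := N%:R * (B * mesh m K) in
  let b := 2 * A * (1 + N%:R) ^+ p / K ^+ r in
  b <= C1 * m%:R `^ (-1 + eps) /\
  2 * a + b * mu + Cs * (ln m%:R ^+ N.-1 / m%:R) * B * (1 + (K + K)) ^+ N
    <= C2 * m%:R `^ (-1 + eps)].
Proof.
move=> N0 A0 Cs0 eps0.
(* [q] dominates the degrees in K of both terms: [p.+1] for rounding and [N.-1 + p + N] for the
   discrepancy, where [N.-1] comes from the logarithm. *)
pose q := (p + N + N).+1; pose delta : R := eps / q%:R.
have delta0 : 0 < delta by rewrite divr_gt0.
(* [r] is fixed before [mu], which will be a moment of order [p + r]. *)
exists (Num.truncn delta^-1).+1 => mu mu0; set r := (Num.truncn _).+1.
have rdelta : 1 <= delta * r%:R.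
  by rewrite -ler_pdivrMl// mulr1 ltW// /r truncnS_gt.
pose c := A * (1 + N%:R) ^+ p; pose l := delta^-1 ^+ N.-1.
have c0 : 0 <= c by rewrite mulr_ge0// exprn_ge0// addr_ge0.
have l0 : 0 <= l by rewrite exprn_ge0// invr_ge0 ltW.
have e0 : 0 <= Cs * l * c * 3 ^+ N.
  by rewrite (mulr_ge0 (mulr_ge0 (mulr_ge0 Cs0 l0) c0))// exprn_ge0.
exists (2 * c), (4 * N%:R * c + 2 * c * mu + Cs * l * c * 3 ^+ N).
split; [by rewrite mulr_ge0| |].
  by rewrite !addr_ge0 ?mulr_ge0.
move=> m m0; set M : R := m%:R; have M1 : 1 <= M by rewrite ler1n.
have M0 : 0 < M := lt_le_trans ltr01 M1.
pose K := M `^ delta.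
have K1 : 1 <= K by rewrite -(powRr0 M) ler_powR// ltW.
have K0 : 0 < K := lt_le_trans ltr01 K1.
have KX k : K ^+ k = M `^ (delta * k%:R).
  by rewrite -powR_mulrn ?(ltW K0)// /K powRrM.
have XE : M `^ (-1 + eps) = K ^+ q / M.
  rewrite powRD; last by rewrite (gt_eqF M0) implybT.
  by rewrite powR_inv1 ?(ltW M0)// mulrC KX /delta divfK// pnatr_eq0.
have KqX k : (k <= q)%N -> K ^+ k / M <= M `^ (-1 + eps).
  by move=> kq; rewrite XE ler_pM2r ?invr_gt0// ler_weXn2l.
have MK : M <= K ^+ r.
  by rewrite KX -{1}(powRr1 (ltW M0)) ler_powR.
(* Since [ln M] is [delta^-1 * ln K], each logarithm costs one power of K. *)
have lnM : ln M <= delta^-1 * K.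
  rewrite -ler_pdivrMl ?invr_gt0// invrK -ln_powR -/K.
  have := expR_ge1Dx (ln K); rewrite lnK ?posrE//; apply: le_trans.
  by rewrite lerDr.
have lnM0 : 0 <= ln M by rewrite ln_ge0.
exists K => // B a b.
have BK : B <= c * K ^+ p.
  rewrite /B /c -mulrA -exprMn ler_wpM2l// lerXn2r ?nnegrE//.
  - by rewrite addr_ge0// mulr_ge0// ltW.
  - by rewrite mulr_ge0 ?addr_ge0// ltW.
  - by rewrite mulrDl mul1r lerD2r.
have B0 : 0 <= B.
  by rewrite mulr_ge0// exprn_ge0// addr_ge0// mulr_ge0// ltW.
have X0 : 0 <= M `^ (-1 + eps) by exact: powR_ge0.
have bX : b <= 2 * c * M `^ (-1 + eps).
  rewrite /b /c -[2 * A * _]mulrA ler_wpM2l ?mulr_ge0//.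
  rewrite (le_trans _ (KqX 0 _))// expr0 div1r lef_pV2 ?posrE//.
  by rewrite exprn_gt0.
split => //.
have aX : 2 * a <= 4 * N%:R * c * M `^ (-1 + eps).
  rewrite (le_trans (_ : _ <= 4 * N%:R * c * (K ^+ p.+1 / M)))//; last first.
    rewrite ler_wpM2l ?mulr_ge0// KqX// /q ltnS -addnA leq_addr//.
  rewrite /a /mesh -/M.
  rewrite (le_trans (_ : _ <= 2 * (N%:R * (c * K ^+ p * ((K + K) / M)))))//.
    by rewrite !ler_wpM2l// ler_wpM2r// divr_ge0 ?addr_ge0 ?(ltW K0) ?(ltW M0).
  by rewrite le_eqVlt; apply/orP; left; apply/eqP; rewrite exprS; field;
    rewrite gt_eqF.
have DX : Cs * (ln M ^+ N.-1 / M) * B * (1 + (K + K)) ^+ N <=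
          Cs * l * c * 3 ^+ N * M `^ (-1 + eps).
  have h1 : Cs * (ln M ^+ N.-1 / M) <= Cs * (l * K ^+ N.-1 / M).
    rewrite ler_wpM2l// ler_pM2r ?invr_gt0// /l -exprMn lerXn2r ?nnegrE//.
    by rewrite mulr_ge0 ?invr_ge0 ?(ltW delta0) ?(ltW K0).
  have h2 : (1 + (K + K)) ^+ N <= 3 ^+ N * K ^+ N.
    by rewrite -exprMn lerXn2r ?nnegrE ?addr_ge0 ?mulr_ge0 ?(ltW K0)//; lra.
  have d0 : 0 <= Cs * (ln M ^+ N.-1 / M).
    by rewrite mulr_ge0// divr_ge0 ?exprn_ge0// ltW.
  have k0 : 0 <= (1 + (K + K)) ^+ N by rewrite exprn_ge0// !addr_ge0 ?(ltW K0).
  rewrite (le_trans (ler_pM (mulr_ge0 d0 B0) k0 (ler_pM d0 B0 h1 BK) h2))//.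
  rewrite [leLHS](_ : _ = Cs * l * c * 3 ^+ N * (K ^+ (N.-1 + p + N) / M)).
    by rewrite ler_wpM2l// KqX// leqW// [(_ + p)%N]addnC -!addnA leq_add2l
      leq_add2r leq_pred.
  by rewrite !exprD; field; rewrite gt_eqF.
rewrite [leRHS]mulrDl lerD// [leRHS]mulrDl lerD//.
by rewrite [leRHS]mulrAC; exact: ler_wpM2r.
Qed.

End rate.

(** * Measurability of the payoff *)

Section payoff.
Context {R : realType} (T x0 : R) (b sigma : R -> R -> R) (g : R -> R)
  (N : nat).
Hypotheses (T_gt0 : 0 < T) (N_gt0 : (0 < N)%N).
Hypothesis smooth : smooth_data T N b sigma g.
Context d (O : measurableType d) (Z : O -> nat -> R).
Hypothesis mZ : forall k, measurable_fun setT (fun w => Z w k).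

Lemma continuously_differentiable_measurable (f : R -> R) :
  continuously_differentiable N f -> measurable_fun setT f.
Proof.
move=> [df _]; apply: continuous_measurable_fun => x.
by apply/differentiable_continuous/derivable1_diffP; exact: (df 0%N).
Qed.

Lemma em_path_measurable i : (i <= N)%N ->
  measurable_fun setT (fun w => em_path T x0 b sigma N (Z w) i).
Proof.
have [dbs _ _] := smooth; elim: i => [_|i IHi iN] /=;
  first exact: measurable_cst.
have t0T : 0 <= i%:R * T / N%:R <= T.
  rewrite divr_ge0 ?mulr_ge0 ?(ltW T_gt0)//= ler_pdivrMr ?ltr0n// mulrC.
  by rewrite ler_wpM2l ?ler_nat ?(ltW T_gt0)// ltnW.
have [db ds] := dbs _ t0T; have IH := IHi (ltnW iN).
have mcomp f : continuously_differentiable N f ->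
    measurable_fun setT (fun w => f (em_path T x0 b sigma N (Z w) i)).
  by move=> df;
    exact: measurableT_comp (continuously_differentiable_measurable df) IH.
apply: measurable_funD; first apply: measurable_funD => //.
  by apply: measurable_funM => //; exact: mcomp.
by apply: measurable_funM => //; apply: measurable_funM => //; exact: mcomp.
Qed.

Lemma payoff_measurable :
  measurable_fun setT (fun w => g (em_path T x0 b sigma N (Z w) N)).
Proof.
have [_ dg _] := smooth.
exact: measurableT_comp (continuously_differentiable_measurable dg)
  (em_path_measurable (leqnn N)).
Qed.

End payoff.

(** * From the almost sure error bound to the mean-square bound *)

Section mean_square.
Context {R : realType}.

(** The difference of the two sides is the empirical variance. It reduces the second moment of an
    average over the points to their marginal laws. *)
Lemma sqr_mean_le m (x : 'I_m -> R) : (0 < m)%N ->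
  (m%:R^-1 * \sum_(k < m) x k) ^+ 2 <= m%:R^-1 * \sum_(k < m) x k ^+ 2.
Proof.
move=> m0; have M0 : m%:R != 0 :> R by rewrite pnatr_eq0 -lt0n.
set a := _ * _; have Sa : \sum_(k < m) x k = m%:R * a by rewrite /a mulVKf.
have : 0 <= m%:R^-1 * \sum_(k < m) (x k - a) ^+ 2.
  by rewrite mulr_ge0// sumr_ge0// => k _; exact: sqr_ge0.
under eq_bigr do rewrite sqrrB.
rewrite big_split/= sumrB sumrMnl -mulr_suml Sa sumr_const card_ord
  -[_ *+ m]mulr_natl.
move=> h; rewrite -subr_ge0 (le_trans h)// le_eqVlt; apply/orP; left.
by apply/eqP; field.
Qed.

End mean_square.

Theorem theorem3p5 (R : realType) (T : R) (T_gt0 : 0 < T)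
    (b sigma : R -> R -> R) (g : R -> R) (x0 : R)
    (d : measure_display) (O : measurableType d) (P : probability O R)
    (F : R -> set (set O)) (W X : R -> O -> R)
    (X_sol : sde_solution P T x0 b sigma F W X)
    (growth : linear_growth T b sigma)
    (weak : em_first_order_weak T x0 b sigma g) :
  exists2 C : R, 0 < C &
  forall N : nat, (0 < N)%N -> smooth_data T N b sigma g ->
  forall Cs : R, 0 < Cs ->
  forall eps : R, 0 < eps ->
  exists2 CepsN : R, 0 < CepsN &
  forall m : nat, (0 < m)%N ->
  forall (d' : measure_display) (O' : measurableType d')
    (P' : probability O' R) (y : 'I_m -> O' -> N.-tuple R),
  rqmc_point_set Cs P' y ->
  (sqrte (\int[P']_w
     (`|(rqmc_estimator T x0 b sigma g (fun k => y k w))%:E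
        - 'E_P[fun w0 => g (X T w0)]| ^+ 2))
   <= (CepsN * m%:R `^ (-1 + eps) + C * (1 / N%:R))%:E)%E.
Proof.
have [Cw hw] := weak _ _ _ _ _ _ X_sol.
(* The factor 2 pays for (x + y)^2 <= 2 x^2 + 2 y^2 instead of Minkowski. *)
exists (2 * (`|Cw| + 1)); first by rewrite mulr_gt0// ltr_wpDl.
move=> N N0 sd Cs Cs0 eps eps0.
pose G z := g (em_path T x0 b sigma N z N).
have [A [p [A0 dG]]] := poly_smooth_uniform (payoff_smooth x0 T_gt0 N0 sd).
have [r rate] := truncation_rate p N0 A0 (ltW Cs0) eps0.
have [mu mu0 momV] := @coord_weight_moment R N (p + r).
have [mu2 mu20 momV2] := @coord_weight_moment R N ((p + r) * 2).
have [C1 [C2 [C10 C20 {}rate]]] := rate mu mu0.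
(* [1 + mu2] stands in for the square root of the moment [mu2], and the last summand 1 ensures
   strict positivity. *)
exists (2 * C1 * (1 + mu2) + 2 * C2 + 1).
  by rewrite ltr_wpDl// addr_ge0 ?mulr_ge0 ?addr_ge0.
move=> m m0 d' O' P' y [_ yunif ydisc].
(* The weak error is applied to the quantile transform of a point of the set. *)
pose Z k w := map_tuple std_gaussian_cdf_inv (y k w).
have gZ k : std_gaussian_vector P' (Z k) := quantile_std_gaussian (yunif k).
have mG k : measurable_fun setT (fun w => G (nth 0 (Z k w))).
  exact: (payoff_measurable x0 T_gt0 N0 sd (gaussian_measurable_nth (gZ k))).
have [K K1 [bC aC]] := rate m m0.
set Xm := m%:R `^ (-1 + eps) in bC aC *; have Xm0 : 0 <= Xm by exact: powR_ge0.
pose est w := m%:R^-1 * \sum_(k < m) G (gaussian_point (y k w)).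
have estE w : rqmc_estimator T x0 b sigma g (y ^~ w) = est w.
  congr (_ * _); apply: eq_bigr => k _.
  by rewrite /em_terminal em_stateE.
pose Z0 := Z (Ordinal m0); pose J := (\int[P']_w G (nth 0 (Z0 w)))%R.
pose V k w := coord_weight N (nth 0 (Z k w)) ^+ (p + r).
have V0 k w : 0 <= V k w by rewrite exprn_ge0// coord_weight_ge0.
have estJ : {ae P', forall w, `|est w - J| <=
    C1 * Xm * (m%:R^-1 * \sum_(k < m) V k w) + C2 * Xm}.
  have open_cube : {ae P', forall w, forall k i, 0 < tnth (y k w) i < 1}.
    by apply: filter_forall => k; exact: uniform_on_open_cube.
  move: ydisc open_cube; apply: filterS2 => w disc u01.
  (* The second [m0] sets the number of grid cells to m. *)
  have := quadrature_error m0 u01 (gZ (Ordinal m0)) N0 m0 K1 A0 dG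
    (mG (Ordinal m0)) (momV _ _ _ _ (gZ (Ordinal m0))).
  move=> /le_trans; apply; apply: lerD.
    rewrite mulrCA ler_wpM2l// mulr_sumr ler_sum// => k _.
    by apply: ler_wpM2r => //; exact: V0.
  apply: le_trans aC; rewrite lerD2l.
  have B0 : 0 <= A * (1 + N%:R * K) ^+ p.
    by rewrite mulr_ge0// exprn_ge0// addr_ge0// mulr_ge0// (le_trans ler01).
  have K0 : 0 <= 1 + (K + K) by rewrite !addr_ge0// (le_trans ler01).
  by rewrite ler_wpM2r ?exprn_ge0// ler_wpM2r.
have [e EX eJ] : exists2 e, ('E_P[fun w0 => g (X T w0)] = e%:E)%E &
    `|J - e| <= (`|Cw| + 1) / N%:R.
  have := hw N N0 _ _ P' Z0 (gZ _).
  have -> : ('E_P'[fun w => g (em_terminal T x0 b sigma (Z0 w))] = J%:E)%E.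
    rewrite unlock /J /Rintegral fineK.
      by apply: eq_integral => w _; rewrite /em_terminal em_stateE.
    apply: integrable_fin_num => //.
    exact: weight_bounded_integrable (gZ _) (differentiable_in0 dG) (mG _).
  (* An infinite expectation would make the left side of the weak error bound infinite, so the bound
     itself yields finiteness. *)
  case: ('E_P[_])%E => [e| |]//= Je; exists e => //.
  rewrite -lee_fin; apply: le_trans Je _;
    rewrite lee_fin ler_pM2r ?invr_gt0 ?ltr0n//.
  by rewrite (le_trans (ler_norm _))// lerDl.
pose c := C2 * Xm + (`|Cw| + 1) / N%:R; pose s := C1 * Xm.
have c0 : 0 <= c by rewrite addr_ge0 ?mulr_ge0 ?divr_ge0 ?addr_ge0.
have s0 : 0 <= s by rewrite mulr_ge0.
have mEst : measurable_fun setT est.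
  by apply: measurable_funM => //; apply: measurable_sum => k; exact: mG.
pose V2 k w := coord_weight N (nth 0 (Z k w)) ^+ ((p + r) * 2).
have mV2 k : measurable_fun setT (V2 k).
  exact: (gaussian_weight_measurable (gZ k)).
have pointwise w : `|est w - J| <=
      C1 * Xm * (m%:R^-1 * \sum_(k < m) V k w) + C2 * Xm ->
    `|est w - e| ^+ 2 <=
      2 * s ^+ 2 * (m%:R^-1 * \sum_(k < m) V2 k w) + 2 * c ^+ 2.
  rewrite -/s; set v := m%:R^-1 * _ => le1.
  have v0 : 0 <= v by rewrite mulr_ge0// sumr_ge0.
  have ->: m%:R^-1 * \sum_(k < m) V2 k w = m%:R^-1 * \sum_(k < m) V k w ^+ 2.
    by congr (_ * _); apply: eq_bigr => k _; rewrite /V2 exprM.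
  have vV2 : s ^+ 2 * v ^+ 2 <= s ^+ 2 * (m%:R^-1 * \sum_(k < m) V k w ^+ 2).
    by rewrite ler_wpM2l ?sqr_ge0// sqr_mean_le.
  have le2 : `|est w - e| <= s * v + c.
    rewrite -(subrKA J) (le_trans (ler_normD _ _))// /c addrA.
    exact: lerD.
  apply: (@le_trans _ _ ((s * v + c) ^+ 2));
    first by rewrite lerXn2r ?nnegrE// addr_ge0// mulr_ge0.
  have := sqr_ge0 (s * v - c); nra.
have bound : (\int[P']_w ((`|est w - e| ^+ 2)%:E) <=
    (2 * s ^+ 2 * mu2 + 2 * c ^+ 2)%:E)%E.
  have mS : measurable_fun setT (fun w => (\sum_(k < m) (V2 k w)%:E)%E).
    by apply: emeasurable_sum => k; exact/measurable_EFinP.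
  have S0 w : (0 <= \sum_(k < m) (V2 k w)%:E)%E.
    by apply: sume_ge0 => k _; rewrite lee_fin exprn_ge0 ?coord_weight_ge0.
  pose q : R := 2 * s ^+ 2 * m%:R^-1.
  have q0 : 0 <= q by rewrite !mulr_ge0 ?sqr_ge0.
  apply: (@le_trans _ _ (\int[P']_w
      (q%:E * (\sum_(k < m) (V2 k w)%:E) + (2 * c ^+ 2)%:E))%E).
    apply: ae_ge0_le_integral => //.
    - apply/measurable_EFinP; apply: measurable_funX.
      apply: measurableT_comp; first exact: normr_measurable.
      exact: measurable_funB.
    - by move=> w _; rewrite adde_ge0 ?mule_ge0 ?lee_fin ?mulr_ge0 ?sqr_ge0.
    - by apply: emeasurable_funD => //; exact: emeasurable_funM.
    - move: estJ; apply: filterS => w /pointwise le3 _.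
      by rewrite sumEFin -EFinM -EFinD lee_fin; rewrite mulrA in le3.
  rewrite ge0_integralD//; last 3 first.
  - by move=> w _; rewrite mule_ge0.
  - exact: emeasurable_funM.
  - by move=> w _; rewrite lee_fin mulr_ge0 ?sqr_ge0.
  rewrite integral_cst//= [X in (_ + _ * X)%E]probability_setT mule1 EFinD
    leeD2r//.
  rewrite ge0_integralZl// ge0_integral_sum//; last 2 first.
  - by move=> k; exact/measurable_EFinP.
  - by move=> k w _; rewrite lee_fin exprn_ge0 ?coord_weight_ge0.
  apply: (@le_trans _ _ (q%:E * (\sum_(k < m) mu2%:E))%E).
    by rewrite lee_wpmul2l// lee_sum// => k _; exact: momV2.
  rewrite sumEFin -EFinM lee_fin sumr_const card_ord -[mu2 *+ m]mulr_natl mulrA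
    /q divfK//.
  by rewrite pnatr_eq0 -lt0n.
under eq_integral do rewrite estE EX -EFinB abse_EFin -EFin_expe.
set rhs := (X in (_ <= X%:E)%E).
have rhs_ge : 2 * s * (1 + mu2) + 2 * c <= rhs.
  rewrite -subr_ge0 [leRHS](_ : _ = Xm)// /rhs /s /c.
  by field; rewrite pnatr_eq0 -lt0n.
have t0 : 0 <= 2 * s * (1 + mu2) + 2 * c.
  by apply: addr_ge0 (mulr_ge0 (mulr_ge0 _ s0) (addr_ge0 ler01 mu20)) (mulr_ge0
    _ c0).
have rhs0 : 0 <= rhs := le_trans t0 rhs_ge.
rewrite -[leRHS]gee0_abs ?lee_fin// -sqrte_sqr lee_sqrt -EFin_expe ?lee_fin
  ?sqr_ge0//.
apply: le_trans bound _; rewrite lee_fin.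
(* After squaring, the claim follows from [mu2 <= (1 + mu2) ^+ 2] and the nonnegativity of the cross
   terms. *)
apply: (@le_trans _ _ ((2 * s * (1 + mu2) + 2 * c) ^+ 2)).
  have : 0 <= s ^+ 2 * mu2 by rewrite mulr_ge0 ?sqr_ge0.
  have : 0 <= s ^+ 2 * mu2 ^+ 2 by rewrite mulr_ge0 ?sqr_ge0.
  have : 0 <= s * c by rewrite mulr_ge0.
  have : 0 <= s * c * mu2 by rewrite !mulr_ge0.
  have := sqr_ge0 s; have := sqr_ge0 c.
  nra.
by rewrite lerXn2r ?nnegrE.
Qed.
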